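(* Let $k$ be a field, let $H$ be a Hopf algebra over $k$ with bijective antipode, let $A$ be a principal $H$-comodule algebra and $B=A^{coH}$. Then $(\Omega^1B)A$ is a direct summand of $\Omega^1A$ in ${}_B\mathbf{M}_A^H$. Consequently, if $M\in\mathbf{M}^H_A$ and $(M,\nabla)$ is a hom-connection with respect to the universal differential graded algebra $\Omega A$ such that $$\nabla\left(\mathrm{Hom}_A^H(\Omega^1A,M)\right)\subseteq M^{coH},$$ then $(M^{coH},\nabla^{coH})$ is a hom-connection with respect to $\Omega B$.
   Context: Let $A$ be a right $H$-comodule algebra with coaction $\varrho^A(a)=a_{(0)}\otimes a_{(1)}$ (an algebra map $A\to A\otimes H$), and $B=A^{coH}=\{b\in A:\varrho^A(b)=b\otimes1\}$. $B\subseteq A$ is a Hopf-Galois extension if $A\otimes_BA\to A\otimes H$, $a\otimes_Ba'\mapsto a\varrho^A(a')$, is bijective. $A$ is a principal comodule algebra if $B\subseteq A$ is a Hopf-Galois extension, the antipode of $H$ is bijective, and there is a left $B$-module right $H$-comodule splitting $s:A\to B\otimes A$ of the multiplication map $B\otimes A\to A$. $\mathbf{M}^H_A$ is the category of $(A,H)$-Hopf modules: right $A$-modules and right $H$-comodules $M$ with coaction satisfying $\varrho^M(ma)=m_{(0)}a_{(0)}\otimes m_{(1)}a_{(1)}$; $\mathrm{Hom}_A^H$ denotes right $A$-linear right $H$-colinear maps. ${}_B\mathbf{M}_A^H$ is the category of those $(A,H)$-Hopf modules that are also left $B$-modules by a right $A$-linear right $H$-colinear $B$-action. $M^{coH}=\{m:\varrho^M(m)=m\otimes1\}$,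 a right $B$-module. The universal differential graded algebra $\Omega A$ is the tensor algebra over $A$ of $\Omega^1A=\ker(\mu:A\otimes A\to A)$, with $da=1\otimes a-a\otimes1$ extended by the graded Leibniz rule; similarly for $B$, and $\Omega^1B\subseteq\Omega^1A$. $(\Omega^1B)A$ is the image of $\Omega^1B\otimes_BA\to\Omega^1A$, $\omega\otimes_Ba\mapsto\omega a$. The $H$-coaction on $\Omega^1A$ is the restriction of the diagonal coaction on $A\otimes A$: $d(a)a'\mapsto d(a_{(0)})a'_{(0)}\otimes a_{(1)}a'_{(1)}$. A hom-connection on a right $A$-module $M$ with respect to $\Omega A$ is a $k$-linear map $\nabla:\mathrm{Hom}_A(\Omega^1A,M)\to M$ with $\nabla(fa)=\nabla(f)a+f(da)$, where $(fa)(\omega)=f(a\omega)$; similarly for $B$. $\nabla^{coH}:\mathrm{Hom}_B(\Omega^1B,M^{coH})\to M^{coH}$ is defined by $\nabla^{coH}(f)=\nabla(\widehat f\circ\Pi)$, where $\Pi:\Omega^1A\to\Omega^1B\otimes_BA\cong(\Omega^1B)A$ is a retraction in ${}_B\mathbf{M}_A^H$ of the inclusion $(\Omega^1B)A\subseteq\Omega^1A$ and $\widehat f(\omega\otimes_Ba)=f(\omega)a$. *)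

(* Defs.v *)
From HB Require Import structures.
From mathcomp Require Import all_boot all_algebra.
From mathcomp Require Import boolp.

Set Implicit Arguments.
Unset Strict Implicit.
Unset Printing Implicit Defensive.

Import GRing.Theory.
Local Open Scope ring_scope.
Local Open Scope quotient_scope.

Section BalancedTensor.
Variables (k : fieldType) (U V : lmodType k).
Variables (R : Type) (ru : U -> R -> U) (lv : R -> V -> V).

(* The congruence on formal sums whose quotient is the k-space U (x)_R V.  The
   scalar in [bteq_bal] only makes the generated relation k-stable. *)
Inductive bteq : seq (U * V) -> seq (U * V) -> Prop :=
| bteq_refl s : bteq s s
| bteq_sym s t : bteq s t -> bteq t s
| bteq_trans s t r : bteq s t -> bteq t r -> bteq s r
| bteq_cat s s' t t' : bteq s s' -> bteq t t' -> bteq (s ++ t) (s' ++ t')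
| bteq_comm s t : bteq (s ++ t) (t ++ s)
| bteq_zero v : bteq [:: (0, v)] [::]
| bteq_addl u u' v : bteq [:: (u + u', v)] [:: (u, v); (u', v)]
| bteq_addr u v v' : bteq [:: (u, v + v')] [:: (u, v); (u, v')]
| bteq_scale (c : k) u v : bteq [:: (c *: u, v)] [:: (u, c *: v)]
| bteq_bal (c : k) u r v : bteq [:: (c *: ru u r, v)] [:: (c *: u, lv r v)].

Definition bteqb (s t : seq (U * V)) : bool := `[< bteq s t >].

Fact bteqb_equiv : equiv_class_of bteqb.
Proof.
split.
- by move=> s; apply/asboolP; apply: bteq_refl.
- by move=> s t; apply/asboolP/asboolP; apply: bteq_sym.
- by move=> t s r /asboolP h1 /asboolP h2; apply/asboolP; apply: bteq_trans h1 h2.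
Qed.
Canonical bteqb_equiv_rel := EquivRelPack bteqb_equiv.

Definition btens := {eq_quot bteqb_equiv_rel}.
HB.instance Definition _ := Choice.on btens.

Definition bten_pi (s : seq (U * V)) : btens := \pi_btens s.
Definition bten (u : U) (v : V) : btens := bten_pi [:: (u, v)].

Lemma bten_piP s t : bteq s t <-> bten_pi s = bten_pi t.
Proof.
split; first by move=> h; apply/eqmodP/asboolP.
by move=> /eqmodP/asboolP.
Qed.

Lemma bten_reprP s : bteq (repr (bten_pi s)) s.
Proof. by apply/bten_piP; rewrite /bten_pi reprK. Qed.

Definition btens_scale_seq (c : k) (s : seq (U * V)) :=
  [seq (c *: p.1, p.2) | p <- s].

Lemma bteq_scale_seq c s t :
  bteq s t -> bteq (btens_scale_seq c s) (btens_scale_seq c t).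
Proof.
elim=> {s t}.
- by move=> s; apply: bteq_refl.
- by move=> s t _; apply: bteq_sym.
- by move=> s t r _ h1 _ h2; apply: bteq_trans h1 h2.
- by move=> s s' t t' _ h1 _ h2; rewrite /btens_scale_seq !map_cat; apply: bteq_cat.
- by move=> s t; rewrite /btens_scale_seq !map_cat; apply: bteq_comm.
- by move=> v; rewrite /= scaler0; apply: bteq_zero.
- by move=> u u' v; rewrite /= scalerDr; apply: bteq_addl.
- by move=> u v v'; apply: bteq_addr.
- by move=> d u v; rewrite /= scalerA mulrC -scalerA; apply: bteq_scale.
- by move=> d u r v; rewrite /= !scalerA; apply: bteq_bal.
Qed.

Definition btens_add (x y : btens) : btens := bten_pi (repr x ++ repr y).
Definition btens_scale (c : k) (x : btens) : btens :=
  bten_pi (btens_scale_seq c (repr x)).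

Lemma bten_pi_ind (P : btens -> Prop) : (forall s, P (bten_pi s)) -> forall x, P x.
Proof. by move=> h x; rewrite -[x]reprK; apply: h. Qed.

Lemma btens_addE s t : btens_add (bten_pi s) (bten_pi t) = bten_pi (s ++ t).
Proof. by apply/bten_piP/bteq_cat; apply: bten_reprP. Qed.

Lemma btens_scaleE c s : btens_scale c (bten_pi s) = bten_pi (btens_scale_seq c s).
Proof. by apply/bten_piP/bteq_scale_seq/bten_reprP. Qed.

Fact btens_addA : associative btens_add.
Proof.
elim/bten_pi_ind=> s; elim/bten_pi_ind=> t; elim/bten_pi_ind=> r.
by rewrite !btens_addE catA.
Qed.
Fact btens_addC : commutative btens_add.
Proof.
elim/bten_pi_ind=> s; elim/bten_pi_ind=> t.
by rewrite !btens_addE; apply/bten_piP/bteq_comm.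
Qed.
Fact btens_add0 : left_id (bten_pi [::]) btens_add.
Proof. by elim/bten_pi_ind=> s; rewrite btens_addE. Qed.

Lemma bteq_scale0 s : bteq (btens_scale_seq 0 s) [::].
Proof.
elim: s => [|[u v] s IH] /=; first exact: bteq_refl.
rewrite scale0r -cat1s; apply: (bteq_trans (t := [::] ++ [::])); last exact: bteq_refl.
by apply: bteq_cat => //; apply: bteq_zero.
Qed.

Lemma bteq_scaleDl a b s :
  bteq (btens_scale_seq (a + b) s) (btens_scale_seq a s ++ btens_scale_seq b s).
Proof.
apply/bten_piP; elim: s => [|[u v] s IH] //=.
rewrite scalerDl -cat1s -btens_addE IH -cat_cons.
have -> : bten_pi [:: (a *: u + b *: u, v)] =
          btens_add (bten_pi [:: (a *: u, v)]) (bten_pi [:: (b *: u, v)]).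
  by rewrite btens_addE; apply/bten_piP/bteq_addl.
have cE p (l : seq (U * V)) : bten_pi (p :: l) = btens_add (bten_pi [:: p]) (bten_pi l).
  by rewrite btens_addE.
rewrite -btens_addE (cE _ (btens_scale_seq a s)) (cE _ (btens_scale_seq b s)).
rewrite -btens_addE -!btens_addA; congr btens_add.
by rewrite !btens_addA; congr btens_add; apply: btens_addC.
Qed.

Fact btens_addN : left_inverse (bten_pi [::]) (btens_scale (-1)) btens_add.
Proof.
elim/bten_pi_ind=> s; rewrite btens_scaleE btens_addE; apply/bten_piP.
have {2}-> : s = btens_scale_seq 1 s.
  by rewrite /btens_scale_seq -[LHS]map_id; apply: eq_map => -[u v]; rewrite /= scale1r.
apply: bteq_trans (bteq_sym (bteq_scaleDl _ _ _)) _.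
by rewrite addNr; apply: bteq_scale0.
Qed.

HB.instance Definition _ :=
  GRing.isZmodule.Build btens btens_addA btens_addC btens_add0 btens_addN.

Fact btens_scaleA a b x : btens_scale a (btens_scale b x) = btens_scale (a * b) x.
Proof.
elim/bten_pi_ind: x => s; rewrite !btens_scaleE; congr bten_pi.
by rewrite /btens_scale_seq -map_comp; apply: eq_map => -[u v]; rewrite /= scalerA.
Qed.
Fact btens_scale1 : left_id 1 btens_scale.
Proof.
elim/bten_pi_ind=> s; rewrite btens_scaleE; congr bten_pi.
by rewrite /btens_scale_seq -[RHS]map_id; apply: eq_map => -[u v]; rewrite /= scale1r.
Qed.
Fact btens_scaleDr : right_distributive btens_scale +%R.
Proof.
move=> c; elim/bten_pi_ind=> s; elim/bten_pi_ind=> t.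
rewrite /GRing.add /= btens_addE !btens_scaleE btens_addE.
by congr bten_pi; rewrite /btens_scale_seq map_cat.
Qed.
Fact btens_scaleDl x : {morph (btens_scale^~ x) : a b / a + b}.
Proof.
move=> a b; elim/bten_pi_ind: x => s; rewrite /= !btens_scaleE.
by rewrite /GRing.add /= btens_addE; apply/bten_piP/bteq_scaleDl.
Qed.

HB.instance Definition _ := GRing.Zmodule_isLmodule.Build k btens
  btens_scaleA btens_scale1 btens_scaleDr btens_scaleDl.

Lemma bten_piE s : bten_pi s = \sum_(p <- s) bten p.1 p.2.
Proof.
elim: s => [|[u v] s IH]; first by rewrite big_nil.
by rewrite big_cons -IH -cat1s [RHS]btens_addE.
Qed.

Lemma btens_reprE x : x = \sum_(p <- repr x) bten p.1 p.2.
Proof. by rewrite -bten_piE /bten_pi reprK. Qed.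

Lemma btens_ind (P : btens -> Prop) :
  P 0 -> (forall u v, P (bten u v)) -> (forall x y, P x -> P y -> P (x + y)) ->
  forall x, P x.
Proof.
move=> P0 Pt PD x; rewrite (btens_reprE x).
by elim: (repr x) => [|p s IH]; rewrite ?big_nil // big_cons; apply: PD.
Qed.

Lemma btenDl u u' v : bten (u + u') v = bten u v + bten u' v.
Proof. by rewrite [RHS]btens_addE; apply/bten_piP/bteq_addl. Qed.
Lemma btenDr u v v' : bten u (v + v') = bten u v + bten u v'.
Proof. by rewrite [RHS]btens_addE; apply/bten_piP/bteq_addr. Qed.
Lemma btenZl c u v : bten (c *: u) v = c *: bten u v.
Proof. by rewrite /GRing.scale /= btens_scaleE. Qed.
Lemma btenZr c u v : bten u (c *: v) = c *: bten u v.
Proof. by rewrite -btenZl; apply/bten_piP/bteq_sym/bteq_scale. Qed.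
Lemma bten_bal u r v : bten (ru u r) v = bten u (lv r v).
Proof.
by apply/bten_piP; have := bteq_bal 1 u r v; rewrite !scale1r.
Qed.

(* The universal property.  [btlift f] is meaningful when [f] is bilinear and
   balanced (see [btliftE]); it is total so that definitions carry no proof. *)
Variable W : lmodType k.
Definition btlift (f : U -> V -> W) (x : btens) : W :=
  \sum_(p <- repr x) f p.1 p.2.

Definition bilin (f : U -> V -> W) : Prop :=
  (forall v, linear (f^~ v)) /\ (forall u, linear (f u)).
Definition balanced (f : U -> V -> W) : Prop :=
  forall u r v, f (ru u r) v = f u (lv r v).

Lemma bilinDl f u u' v : bilin f -> f (u + u') v = f u v + f u' v.
Proof. by move=> [h _]; have := h v 1 u u'; rewrite !scale1r. Qed.
Lemma bilinDr f u v v' : bilin f -> f u (v + v') = f u v + f u v'.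
Proof. by move=> [_ h]; have := h u 1 v v'; rewrite !scale1r. Qed.
Lemma bilin0l f v : bilin f -> f 0 v = 0.
Proof. by move=> h; apply: (addrI (f 0 v)); rewrite -bilinDl // !addr0. Qed.
Lemma bilin0r f u : bilin f -> f u 0 = 0.
Proof. by move=> h; apply: (addrI (f u 0)); rewrite -bilinDr // !addr0. Qed.
Lemma bilinZl f c u v : bilin f -> f (c *: u) v = c *: f u v.
Proof. by move=> h; have := h.1 v c u 0; rewrite /= !addr0 bilin0l // addr0. Qed.
Lemma bilinZr f c u v : bilin f -> f u (c *: v) = c *: f u v.
Proof. by move=> h; have := h.2 u c v 0; rewrite !addr0 bilin0r // addr0. Qed.

Lemma btlift_pi f s : bilin f -> balanced f ->
  btlift f (bten_pi s) = \sum_(p <- s) f p.1 p.2.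
Proof.
move=> hf bf; rewrite /btlift.
suff: forall r t, bteq r t -> \sum_(p <- r) f p.1 p.2 = \sum_(p <- t) f p.1 p.2.
  by apply; apply: bten_reprP.
move=> r t; elim=> {r t} //.
- by move=> s1 t1 r1 _ h1 _ h2; rewrite h1.
- by move=> s1 s2 t1 t2 _ h1 _ h2; rewrite !big_cat /= h1 h2.
- by move=> s1 t1; rewrite !big_cat /= addrC.
- by move=> v; rewrite big_seq1 big_nil /= bilin0l.
- by move=> u u' v; rewrite !big_cons big_nil /= bilinDl // !addr0.
- by move=> u v v'; rewrite !big_cons big_nil /= bilinDr // !addr0.
- by move=> c u v; rewrite !big_seq1 /= bilinZl // bilinZr.
- by move=> c u r v; rewrite !big_seq1 /= !bilinZl // bf.
Qed.

Lemma btliftE f u v : bilin f -> balanced f -> btlift f (bten u v) = f u v.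
Proof. by move=> hf bf; rewrite btlift_pi // big_seq1. Qed.

Lemma btlift_linear f : bilin f -> balanced f -> linear (btlift f).
Proof.
move=> hf bf c x y; elim/bten_pi_ind: x => s; elim/bten_pi_ind: y => t.
have -> : c *: bten_pi s + bten_pi t = bten_pi (btens_scale_seq c s ++ t).
  by rewrite -btens_addE -btens_scaleE.
rewrite !btlift_pi // big_cat /= /btens_scale_seq big_map scaler_sumr; congr (_ + _).
by apply: eq_bigr => p _; rewrite /= bilinZl.
Qed.

End BalancedTensor.

Section Tensor.
Variable k : fieldType.

Definition tens (U V : lmodType k) : lmodType k :=
  btens (fun (u : U) (c : k) => c *: u) (fun (c : k) (v : V) => c *: v).

Definition ten (U V : lmodType k) (u : U) (v : V) : tens U V := bten _ _ u v.

Definition tlift (U V W : lmodType k) (f : U -> V -> W) : tens U V -> W :=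
  btlift f.

End Tensor.

Notation "U ⊗ V" := (tens U V) (at level 40, left associativity) : type_scope.
Notation "u ⊗ v" := (ten u v) (at level 40, left associativity) : ring_scope.

Section TensorTheory.
Variable k : fieldType.
Implicit Types U V W X Y Z : lmodType k.

Lemma bilin_balanced U V W (f : U -> V -> W) :
  bilin f -> balanced (fun u (c : k) => c *: u) (fun c v => c *: v) f.
Proof. by move=> hf u c v; rewrite (bilinZl _ _ _ hf) (bilinZr _ _ _ hf). Qed.

Lemma tliftE U V W (f : U -> V -> W) u v : bilin f -> tlift f (u ⊗ v) = f u v.
Proof. by move=> hf; apply: btliftE => //; apply: bilin_balanced. Qed.

Lemma tlift_linear U V W (f : U -> V -> W) : bilin f -> linear (tlift f).
Proof. by move=> hf; apply: btlift_linear => //; apply: bilin_balanced. Qed.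

Lemma tens_ind U V (P : (U ⊗ V)%type -> Prop) :
  P 0 -> (forall u v, P (u ⊗ v)) -> (forall x y, P x -> P y -> P (x + y)) ->
  forall x, P x.
Proof. exact: btens_ind. Qed.

Lemma tenDl U V (u u' : U) (v : V) : (u + u') ⊗ v = u ⊗ v + u' ⊗ v.
Proof. exact: btenDl. Qed.
Lemma tenDr U V (u : U) (v v' : V) : u ⊗ (v + v') = u ⊗ v + u ⊗ v'.
Proof. exact: btenDr. Qed.
Lemma tenZl U V c (u : U) (v : V) : (c *: u) ⊗ v = c *: (u ⊗ v).
Proof. exact: btenZl. Qed.
Lemma tenZr U V c (u : U) (v : V) : u ⊗ (c *: v) = c *: (u ⊗ v).
Proof. exact: btenZr. Qed.

Lemma bilin_ten U V : bilin (@ten k U V).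
Proof. by split=> [v c x y|u c x y]; rewrite (tenDl, tenDr) (tenZl, tenZr). Qed.

Fact ten_linear U V (u : U) : linear (@ten k U V u).
Proof. exact: (bilin_ten U V).2. Qed.
HB.instance Definition _ U V (u : U) :=
  GRing.isLinear.Build k _ _ _ (@ten k U V u) (ten_linear u).

Lemma bilin_linear U V W (f : U -> V -> W) :
  (forall v c x y, f (c *: x + y) v = c *: f x v + f y v) ->
  (forall u c x y, f u (c *: x + y) = c *: f u x + f u y) -> bilin f.
Proof. by move=> h1 h2; split=> [v c x y|u c x y]; rewrite ?h1 ?h2. Qed.

Section Tmap.
Variables (U V X Y : lmodType k).

Definition tmap (f : U -> X) (g : V -> Y) : (U ⊗ V)%type -> (X ⊗ Y)%type :=
  tlift (fun u v => f u ⊗ g v).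

Variables (f : {linear U -> X}) (g : {linear V -> Y}).

Fact tmap_bilin : bilin (fun u v => f u ⊗ g v).
Proof.
by apply: bilin_linear => [v|u] c x y; rewrite linearP (tenDl, tenDr) (tenZl, tenZr).
Qed.

Lemma tmapE u v : tmap f g (u ⊗ v) = f u ⊗ g v.
Proof. by rewrite /tmap tliftE //; apply: tmap_bilin. Qed.

HB.instance Definition _ :=
  GRing.isLinear.Build k _ _ _ (tmap f g) (tlift_linear tmap_bilin).
End Tmap.

Section Tmap2.
Variables (U U' V V' X Y : lmodType k).

(* The bilinear map (u (x) v, u' (x) v') |-> f u u' (x) g v v'. *)
Definition tmap2 (f : U -> U' -> X) (g : V -> V' -> Y)
    (x : (U ⊗ V)%type) (y : (U' ⊗ V')%type) : (X ⊗ Y)%type :=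
  tlift (fun u v => tlift (fun u' v' => f u u' ⊗ g v v') y) x.

Variables (f : U -> U' -> X) (g : V -> V' -> Y).
Hypotheses (hf : bilin f) (hg : bilin g).

Fact tmap2_bilin_in u v : bilin (fun u' v' => f u u' ⊗ g v v').
Proof.
apply: bilin_linear => [v'|u'] c x y.
- by rewrite (bilinDr _ _ _ hf) (bilinZr _ _ _ hf) tenDl tenZl.
- by rewrite (bilinDr _ _ _ hg) (bilinZr _ _ _ hg) tenDr tenZr.
Qed.

Fact tmap2_bilin_out (y : (U' ⊗ V')%type) :
  bilin (fun u v => tlift (fun u' v' => f u u' ⊗ g v v') y).
Proof.
apply: bilin_linear => [v|u] c x x'; rewrite /tlift /btlift scaler_sumr -big_split;
  apply: eq_bigr => p _ /=.
- by rewrite (bilinDl _ _ _ hf) (bilinZl _ _ _ hf) tenDl tenZl.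
- by rewrite (bilinDl _ _ _ hg) (bilinZl _ _ _ hg) tenDr tenZr.
Qed.

Lemma tmap2E u v u' v' : tmap2 f g (u ⊗ v) (u' ⊗ v') = f u u' ⊗ g v v'.
Proof. by rewrite /tmap2 tliftE ?tliftE //; [apply: tmap2_bilin_in | apply: tmap2_bilin_out]. Qed.

Lemma tmap2_bilin : bilin (tmap2 f g).
Proof.
split=> [y c x x'|x c y y']; first exact: (tlift_linear (tmap2_bilin_out y)).
rewrite /tmap2 {1 3 5}/tlift /btlift scaler_sumr -big_split; apply: eq_bigr => p _ /=.
exact: (tlift_linear (tmap2_bilin_in p.1 p.2)).
Qed.
End Tmap2.

Section Tassoc.
Variables (U V W : lmodType k).

Definition tassoc : ((U ⊗ V) ⊗ W)%type -> (U ⊗ (V ⊗ W))%type :=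
  tlift (fun x w => tlift (fun u v => u ⊗ (v ⊗ w)) x).

Fact tassoc_bilin_in (w : W) : bilin (fun (u : U) (v : V) => u ⊗ (v ⊗ w)).
Proof.
by apply: bilin_linear => [v|u] c x y; rewrite ?tenDl ?tenZl ?tenDr ?tenZr.
Qed.

Fact tassoc_bilin :
  bilin (fun (x : (U ⊗ V)%type) (w : W) => tlift (fun u v => u ⊗ (v ⊗ w)) x).
Proof.
split=> [w|x c w w']; first exact: (tlift_linear (tassoc_bilin_in w)).
rewrite /tlift /btlift scaler_sumr -big_split; apply: eq_bigr => p _ /=.
by rewrite !tenDr !tenZr.
Qed.

Lemma tassocE u v w : tassoc (u ⊗ v ⊗ w) = u ⊗ (v ⊗ w).
Proof.
by rewrite /tassoc !tliftE //; [apply: tassoc_bilin_in | apply: tassoc_bilin].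
Qed.

HB.instance Definition _ :=
  GRing.isLinear.Build k _ _ _ tassoc (tlift_linear tassoc_bilin).
End Tassoc.

End TensorTheory.

Lemma bilin_mul (k : fieldType) (A : algType k) :
  bilin (fun x y : A => x * y).
Proof.
apply: bilin_linear => [v|u] c x y.
- by rewrite mulrDl scalerAl.
- by rewrite mulrDr scalerAr.
Qed.

Arguments tassoc {k U V W}.

Section TmapTheory.
Variable k : fieldType.
Implicit Types U V W X Y Z : lmodType k.

Lemma tmap_comp U V X Y Z W (f : {linear U -> X}) (g : {linear V -> Y})
    (f' : {linear X -> Z}) (g' : {linear Y -> W}) x :
  tmap f' g' (tmap f g x) = tmap (f' \o f) (g' \o g) x.
Proof.
elim/tens_ind: x => [|u v|x y hx hy]; first by rewrite !linear0.
- by rewrite !tmapE.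
- by rewrite !linearD /= hx hy.
Qed.

Lemma eq_tmap U V X Y (f f' : U -> X) (g g' : V -> Y) :
  f =1 f' -> g =1 g' -> tmap f g =1 tmap f' g'.
Proof. by move=> /funext-> /funext->. Qed.

Lemma tmap_id U V x : tmap (idfun : U -> U) (idfun : V -> V) x = x.
Proof.
elim/tens_ind: x => [|u v|x y hx hy]; first by rewrite linear0.
- by rewrite tmapE.
- by rewrite linearD /= hx hy.
Qed.

Lemma tassoc_tmap U V W X Y Z (f : {linear U -> X}) (g : {linear V -> Y})
    (h : {linear W -> Z}) x :
  tassoc (tmap (tmap f g) h x) = tmap f (tmap g h) (tassoc x).
Proof.
elim/tens_ind: x => [|t w|x y hx hy]; first by rewrite !linear0.
- rewrite tmapE /=; elim/tens_ind: t => [|u v|x y hx hy].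
  + by rewrite linear0 !(bilin0l _ (@bilin_ten _ _ _)) !linear0.
  + by rewrite tmapE !tassocE tmapE /= tmapE.
  + by rewrite linearD /= !tenDl !linearD /= hx hy.
- by rewrite !linearD /= hx hy.
Qed.

End TmapTheory.

Section Multiplication.
Variables (k : fieldType) (A : algType k).

Definition lmulf (a x : A) : A := a * x.
Definition rmulf (a x : A) : A := x * a.

Fact lmulf_linear a : linear (lmulf a).
Proof. exact: (bilin_mul A).2. Qed.
HB.instance Definition _ a :=
  GRing.isLinear.Build k _ _ _ (lmulf a) (lmulf_linear a).

Fact rmulf_linear a : linear (rmulf a).
Proof. exact: (bilin_mul A).1. Qed.
HB.instance Definition _ a :=
  GRing.isLinear.Build k _ _ _ (rmulf a) (rmulf_linear a).

Definition mu : (A ⊗ A)%type -> A := tlift (fun x y => x * y).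
HB.instance Definition _ :=
  GRing.isLinear.Build k _ _ _ mu (tlift_linear (bilin_mul A)).

Lemma muE x y : mu (x ⊗ y) = x * y.
Proof. by rewrite /mu tliftE //; apply: bilin_mul. Qed.

End Multiplication.

Definition tmul (k : fieldType) (A B : algType k) :
    (A ⊗ B)%type -> (A ⊗ B)%type -> (A ⊗ B)%type :=
  tmap2 (fun x y : A => x * y) (fun x y : B => x * y).

Lemma tmulE (k : fieldType) (A B : algType k) (a a' : A) (b b' : B) :
  tmul (a ⊗ b) (a' ⊗ b') = (a * a') ⊗ (b * b').
Proof. by rewrite /tmul tmap2E //; apply: bilin_mul. Qed.

Lemma tmul_bilin (k : fieldType) (A B : algType k) : bilin (@tmul k A B).
Proof. by apply: tmap2_bilin; apply: bilin_mul. Qed.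

Record hopf_algebra (k : fieldType) := HopfAlgebra {
  hopf_alg :> algType k;
  comul : {linear hopf_alg -> (hopf_alg ⊗ hopf_alg)%type};
  counit : {scalar hopf_alg};
  antipode : {linear hopf_alg -> hopf_alg};
  comulA : forall h,
    tassoc (tmap comul idfun (comul h)) = tmap idfun comul (comul h);
  comul_counitl : forall h, tlift (fun x y => counit x *: y) (comul h) = h;
  comul_counitr : forall h, tlift (fun x y => counit y *: x) (comul h) = h;
  comul1 : comul 1 = 1 ⊗ 1;
  comulM : forall g h, comul (g * h) = tmul (comul g) (comul h);
  counit1 : counit 1 = 1;
  counitM : forall g h, counit (g * h) = counit g * counit h;
  antipodel : forall h,
    tlift (fun x y => antipode x * y) (comul h) = counit h *: 1;
  antipoder : forall h,
    tlift (fun x y => x * antipode y) (comul h) = counit h *: 1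
}.

Arguments comul {k H} : rename.
Arguments counit {k H} : rename.
Arguments antipode {k H} : rename.

Definition is_coaction (k : fieldType) (H : hopf_algebra k) (M : lmodType k)
    (rho : M -> (M ⊗ H)%type) : Prop :=
  (forall m, tassoc (tmap rho idfun (rho m)) = tmap idfun comul (rho m)) /\
  (forall m, tlift (fun n h => counit h *: n) (rho m) = m).

Record comodule_algebra (k : fieldType) (H : hopf_algebra k) := ComoduleAlgebra {
  ca_alg :> algType k;
  coact : {linear ca_alg -> (ca_alg ⊗ H)%type};
  coactP : is_coaction coact;
  coact1 : coact 1 = 1 ⊗ 1;
  coactM : forall a b, coact (a * b) = tmul (coact a) (coact b)
}.

Arguments coact {k H A} : rename.

Section Coinvariants.
Variables (k : fieldType) (H : hopf_algebra k) (A : comodule_algebra H).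

Definition coinv_pred : {pred A} := [pred a : A | coact a == a ⊗ 1].

Fact coinv_subalg_closed : subalg_closed coinv_pred.
Proof.
split=> [|c a b|a b]; rewrite !inE ?coact1 //.
- by move=> /eqP ha /eqP hb; rewrite linearP ha hb tenDl tenZl.
- by move=> /eqP ha /eqP hb; rewrite coactM ha hb tmulE mulr1.
Qed.
HB.instance Definition _ := GRing.isSubalgClosed.Build k A coinv_pred
  coinv_subalg_closed.

Record coinv := Coinv { coinv_val :> A; _ : coinv_val \in coinv_pred }.
HB.instance Definition _ := [isSub for coinv_val].
HB.instance Definition _ := [Choice of coinv by <:].
HB.instance Definition _ := [SubChoice_isSubAlgebra of coinv by <:].
HB.instance Definition _ := GRing.Linear.copy coinv_val (val : coinv -> A).

End Coinvariants.

Section RightModules.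
Variables (k : fieldType) (R : algType k).

Record rmodule := RModule {
  rm_space :> lmodType k;
  ract : rm_space -> R -> rm_space;
  ract_bilin : bilin ract;
  ractA : forall m a b, ract (ract m a) b = ract m (a * b);
  ract1 : forall m, ract m 1 = m
}.

Record rhom (M N : rmodule) := RHom {
  rhom_fun :> M -> N;
  rhom_linear : linear rhom_fun;
  rhom_ract : forall m a, rhom_fun (ract m a) = ract (rhom_fun m) a
}.
HB.instance Definition _ M N (f : rhom M N) :=
  GRing.isLinear.Build k _ _ _ (rhom_fun f) (rhom_linear f).

Lemma rhomP M N (f g : rhom M N) : f =1 g -> f = g.
Proof.
case: f g => [f hf af] [g hg ag] /= /funext e; subst g.
by rewrite (Prop_irrelevance hf hg) (Prop_irrelevance af ag).
Qed.

HB.instance Definition _ M N := gen_eqMixin (rhom M N).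
HB.instance Definition _ M N := gen_choiceMixin (rhom M N).

Section RHomModule.
Variables M N : rmodule.

Lemma ractDl (P : rmodule) (m n : P) a : ract (m + n) a = ract m a + ract n a.
Proof. exact: bilinDl (ract_bilin P). Qed.
Lemma ractZl (P : rmodule) c (m : P) a : ract (c *: m) a = c *: ract m a.
Proof. exact: bilinZl (ract_bilin P). Qed.
Lemma ract0l (P : rmodule) a : ract (0 : P) a = 0.
Proof. exact: bilin0l (ract_bilin P). Qed.

Fact rhom_comb_linear (c : k) (f g : rhom M N) :
  linear (fun m => c *: f m + g m).
Proof.
move=> d x y; rewrite !(rhom_linear _ d x y) !scalerDr !scalerA (mulrC c d).
by rewrite addrACA.
Qed.
Fact rhom_comb_ract (c : k) (f g : rhom M N) m a :
  c *: f (ract m a) + g (ract m a) = ract (c *: f m + g m) a.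
Proof. by rewrite !rhom_ract ractDl ractZl. Qed.
Definition rhom_comb c f g : rhom M N :=
  RHom (rhom_comb_linear c f g) (rhom_comb_ract c f g).

Fact rhom0_linear : linear (fun _ : M => 0 : N).
Proof. by move=> c x y; rewrite scaler0 addr0. Qed.
Fact rhom0_ract (m : M) a : 0 = ract (0 : N) a.
Proof. by rewrite ract0l. Qed.
Definition rhom0 : rhom M N := RHom rhom0_linear rhom0_ract.

Definition rhom_add f g := rhom_comb 1 f g.
Definition rhom_scale c f := rhom_comb c f rhom0.
Definition rhom_opp f := rhom_scale (-1) f.

Fact rhom_addA : associative rhom_add.
Proof. by move=> f g h; apply: rhomP => m; rewrite /= !scale1r addrA. Qed.
Fact rhom_addC : commutative rhom_add.
Proof. by move=> f g; apply: rhomP => m; rewrite /= !scale1r addrC. Qed.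
Fact rhom_add0 : left_id rhom0 rhom_add.
Proof. by move=> f; apply: rhomP => m; rewrite /= scaler0 add0r. Qed.
Fact rhom_addN : left_inverse rhom0 rhom_opp rhom_add.
Proof.
by move=> f; apply: rhomP => m; rewrite /= scale1r addr0 scaleN1r addNr.
Qed.
HB.instance Definition _ :=
  GRing.isZmodule.Build (rhom M N) rhom_addA rhom_addC rhom_add0 rhom_addN.

Lemma rhom_addE (f g : rhom M N) m : (f + g) m = f m + g m.
Proof. by rewrite /= scale1r. Qed.

Fact rhom_scaleA a b f : rhom_scale a (rhom_scale b f) = rhom_scale (a * b) f.
Proof. by apply: rhomP => m; rewrite /= !addr0 scalerA. Qed.
Fact rhom_scale1 : left_id 1 rhom_scale.
Proof. by move=> f; apply: rhomP => m; rewrite /= addr0 scale1r. Qed.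
Fact rhom_scaleDr : right_distributive rhom_scale +%R.
Proof.
by move=> c f g; apply: rhomP => m; rewrite /= !addr0 !scale1r scalerDr.
Qed.
Fact rhom_scaleDl f : {morph (rhom_scale^~ f) : a b / a + b}.
Proof.
by move=> a b; apply: rhomP => m; rewrite /= !addr0 scale1r scalerDl.
Qed.
HB.instance Definition _ := GRing.Zmodule_isLmodule.Build k (rhom M N)
  rhom_scaleA rhom_scale1 rhom_scaleDr rhom_scaleDl.

Lemma rhom_scaleE c (f : rhom M N) m : (c *: f) m = c *: f m.
Proof. by rewrite /= addr0. Qed.
End RHomModule.

Section RHomComp.
Variables M N P : rmodule.
Variables (g : rhom N P) (f : rhom M N).
Fact rhom_comp_linear : linear (fun m => g (f m)).
Proof. by move=> c x y; rewrite !rhom_linear. Qed.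
Fact rhom_comp_ract m a : g (f (ract m a)) = ract (g (f m)) a.
Proof. by rewrite !rhom_ract. Qed.
Definition rhom_comp : rhom M P := RHom rhom_comp_linear rhom_comp_ract.
End RHomComp.

End RightModules.

Section UniversalCalculus.
Variables (k : fieldType) (R : algType k).

Definition omega_pred : {pred (R ⊗ R)%type} := [pred x : (R ⊗ R)%type | mu x == 0].

Fact omega_submod_closed : submod_closed omega_pred.
Proof.
split=> [|c x y]; rewrite !inE ?linear0 //.
by move=> /eqP hx /eqP hy; rewrite linearP /= hx hy scaler0 addr0.
Qed.
HB.instance Definition _ :=
  GRing.isSubmodClosed.Build k (R ⊗ R)%type omega_pred omega_submod_closed.

(* Degree one of the universal differential graded algebra. *)
Record omega := Omega { omega_val :> (R ⊗ R)%type; _ : omega_val \in omega_pred }.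
HB.instance Definition _ := [isSub for omega_val].
HB.instance Definition _ := [Choice of omega by <:].
HB.instance Definition _ := [SubChoice_isSubLmodule of omega by <:].
HB.instance Definition _ :=
  GRing.Linear.copy omega_val (val : omega -> (R ⊗ R)%type).

Lemma omegaP (w : omega) : mu (val w) = 0.
Proof. by case: w => x /=; rewrite inE => /eqP. Qed.

Lemma mu_lmul a (x : (R ⊗ R)%type) : mu (tmap (lmulf a) idfun x) = a * mu x.
Proof.
elim/tens_ind: x => [|u v|x y hx hy]; first by rewrite !linear0 mulr0.
- by rewrite tmapE !muE /= /lmulf mulrA.
- by rewrite !linearD /= hx hy mulrDr.
Qed.
Lemma mu_rmul a (x : (R ⊗ R)%type) : mu (tmap idfun (rmulf a) x) = mu x * a.
Proof.
elim/tens_ind: x => [|u v|x y hx hy]; first by rewrite !linear0 mul0r.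
- by rewrite tmapE !muE /= /rmulf mulrA.
- by rewrite !linearD /= hx hy mulrDl.
Qed.

Fact omega_lact_subproof a (w : omega) :
  tmap (lmulf a) idfun (val w) \in omega_pred.
Proof. by rewrite inE mu_lmul omegaP mulr0. Qed.
Definition omega_lact (a : R) (w : omega) : omega :=
  Omega (omega_lact_subproof a w).

Fact omega_ract_subproof (w : omega) a :
  tmap idfun (rmulf a) (val w) \in omega_pred.
Proof. by rewrite inE mu_rmul omegaP mul0r. Qed.
Definition omega_ract (w : omega) (a : R) : omega :=
  Omega (omega_ract_subproof w a).

Fact omega_d_subproof (a : R) : 1 ⊗ a - a ⊗ 1 \in omega_pred.
Proof. by rewrite inE linearB /= !muE mulr1 mul1r subrr. Qed.
Definition omega_d (a : R) : omega := Omega (omega_d_subproof a).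

Lemma tmap_lmul_bilin : bilin (fun a (x : (R ⊗ R)%type) => tmap (lmulf a) idfun x).
Proof.
split=> [x c a b|a]; last exact: linearP.
elim/tens_ind: x => [|u v|x y hx hy]; first by rewrite !linear0 /= ?scaler0 addr0.
- by rewrite !tmapE /= /lmulf mulrDl -scalerAl tenDl tenZl.
- by rewrite !linearD /= hx hy ?scalerDr addrACA.
Qed.
Lemma tmap_rmul_bilin : bilin (fun (x : (R ⊗ R)%type) a => tmap idfun (rmulf a) x).
Proof.
split=> [a|x c a b]; first exact: linearP.
elim/tens_ind: x => [|u v|x y hx hy]; first by rewrite !linear0 /= ?scaler0 addr0.
- by rewrite !tmapE /= /rmulf mulrDr -scalerAr tenDr tenZr.
- by rewrite !linearD /= hx hy ?scalerDr addrACA.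
Qed.

Lemma omega_lact_bilin : bilin omega_lact.
Proof.
split=> [w c a b|a c x y]; apply: val_inj; rewrite [RHS]linearP.
- exact: tmap_lmul_bilin.1.
- exact: (linearP (tmap (lmulf a) idfun) c (val x) (val y)).
Qed.
HB.instance Definition _ a := GRing.isLinear.Build k _ _ _
  (omega_lact a) (omega_lact_bilin.2 a).

Lemma omega_ract_bilin : bilin omega_ract.
Proof.
split=> [a c x y|w c a b]; apply: val_inj; rewrite [RHS]linearP.
- exact: (linearP (tmap idfun (rmulf a)) c (val x) (val y)).
- exact: tmap_rmul_bilin.2.
Qed.

Lemma omega_lactA a b w : omega_lact a (omega_lact b w) = omega_lact (a * b) w.
Proof.
apply: val_inj => /=; rewrite tmap_comp; apply: eq_tmap => // x /=.
by rewrite /lmulf mulrA.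
Qed.
Lemma omega_lact1 w : omega_lact 1 w = w.
Proof.
apply: val_inj => /=; rewrite -[RHS]tmap_id; apply: eq_tmap => // x /=.
by rewrite /lmulf mul1r.
Qed.
Lemma omega_ractA w a b : omega_ract (omega_ract w a) b = omega_ract w (a * b).
Proof.
apply: val_inj => /=; rewrite tmap_comp; apply: eq_tmap => // x /=.
by rewrite /rmulf mulrA.
Qed.
Lemma omega_ract1 w : omega_ract w 1 = w.
Proof.
apply: val_inj => /=; rewrite -[RHS]tmap_id; apply: eq_tmap => // x /=.
by rewrite /rmulf mulr1.
Qed.
Lemma omega_lract a w b :
  omega_lact a (omega_ract w b) = omega_ract (omega_lact a w) b.
Proof. by apply: val_inj => /=; rewrite !tmap_comp; apply: eq_tmap. Qed.

Lemma omega_dM a b :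
  omega_d (a * b) = omega_ract (omega_d a) b + omega_lact a (omega_d b).
Proof.
apply: val_inj; rewrite /= !linearB /= !tmapE /= /rmulf /lmulf.
by rewrite !mul1r !mulr1 addrA addrNK.
Qed.

Definition omega_rmod : rmodule R :=
  RModule omega_ract_bilin omega_ractA omega_ract1.

Section HomConnection.
Variable M : rmodule R.

Fact rhom_omega_linear (f : rhom omega_rmod M) a :
  linear (fun w : omega_rmod => f (omega_lact a w)).
Proof. by move=> c x y; rewrite (omega_lact_bilin.2 a c x y) linearP. Qed.
Fact rhom_omega_ract (f : rhom omega_rmod M) a (w : omega_rmod) b :
  f (omega_lact a (ract w b)) = ract (f (omega_lact a w)) b.
Proof. by rewrite -rhom_ract /= omega_lract. Qed.
(* (f a)(w) = f (a w) *)
Definition rhom_omega_act (f : rhom omega_rmod M) (a : R) : rhom omega_rmod M :=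
  RHom (rhom_omega_linear f a) (rhom_omega_ract f a).

Definition hom_connection (nabla : {linear rhom omega_rmod M -> M}) : Prop :=
  forall f a, nabla (rhom_omega_act f a) = ract (nabla f) a + f (omega_d a).
End HomConnection.

End UniversalCalculus.

Section HopfModules.
Variables (k : fieldType) (H : hopf_algebra k) (A : comodule_algebra H).
Local Notation B := (coinv A).

Record hopf_module := HopfModule {
  hm_rmod :> rmodule A;
  hm_coact : {linear hm_rmod -> (hm_rmod ⊗ H)%type};
  hm_coactP : is_coaction hm_coact;
  hm_coact_ract : forall m a, hm_coact (ract m a) =
    tmap2 (@ract k A hm_rmod) (fun x y : H => x * y) (hm_coact m) (coact a)
}.

(* Objects of the category of (A, H)-Hopf modules with a compatible left
   B-action. *)
Record bhopf_module := BHopfModule {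
  bh_hopf :> hopf_module;
  blact : B -> bh_hopf -> bh_hopf;
  blact_bilin : bilin blact;
  blactA : forall b c m, blact b (blact c m) = blact (b * c) m;
  blact1 : forall m, blact 1 m = m;
  blact_ract : forall b m a, blact b (ract m a) = ract (blact b m) a;
  blact_coact : forall b m,
    hm_coact bh_hopf (blact b m) = tmap (blact b) idfun (hm_coact bh_hopf m)
}.

Definition colinear (M N : hopf_module) (f : M -> N) : Prop :=
  forall m, hm_coact N (f m) = tmap f idfun (hm_coact M m).

Record bhom (M N : bhopf_module) := BHom {
  bhom_rhom :> rhom M N;
  bhom_colinear : colinear bhom_rhom;
  bhom_blact : forall b m, bhom_rhom (blact b m) = blact b (bhom_rhom m)
}.

Definition hm_coinv_pred (M : hopf_module) : {pred M} :=
  [pred m : M | hm_coact M m == m ⊗ 1].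
Arguments hm_coinv_pred : clear implicits.

(* t lies in the image of N (x) V in U (x) V. *)
Definition in_tens (U V : lmodType k) (N : U -> Prop) (t : (U ⊗ V)%type) : Prop :=
  exists2 s : seq (U * V),
    (forall p, p \in s -> N p.1) & t = \sum_(p <- s) p.1 ⊗ p.2.

Definition is_subobject (X : bhopf_module) (N : X -> Prop) : Prop :=
  [/\ N 0,
      forall (c : k) x y, N x -> N y -> N (c *: x + y),
      forall x (a : A), N x -> N (ract x a),
      forall (b : B) x, N x -> N (blact b x)
    & forall x, N x -> in_tens N (hm_coact X x)].

Definition direct_summand (X : bhopf_module) (N : X -> Prop) : Prop :=
  is_subobject N /\
  exists N' : X -> Prop,
    [/\ is_subobject N',
        forall x, exists y z, [/\ N y, N' z & x = y + z]
      & forall x, N x -> N' x -> x = 0].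

Section HopfCoinvariants.
Variable M : hopf_module.

Fact hm_coinv_submod_closed : submod_closed (hm_coinv_pred M).
Proof.
split=> [|c x y]; rewrite !inE ?linear0.
  by rewrite (bilin0l _ (@bilin_ten _ _ _)).
by move=> /eqP hx /eqP hy; rewrite linearP /= hx hy tenDl tenZl.
Qed.
HB.instance Definition _ :=
  GRing.isSubmodClosed.Build k M (hm_coinv_pred M) hm_coinv_submod_closed.

Record hm_coinv := HmCoinv { hm_coinv_val :> M; _ : hm_coinv_val \in hm_coinv_pred M }.
HB.instance Definition _ := [isSub for hm_coinv_val].
HB.instance Definition _ := [Choice of hm_coinv by <:].
HB.instance Definition _ := [SubChoice_isSubLmodule of hm_coinv by <:].
HB.instance Definition _ :=
  GRing.Linear.copy hm_coinv_val (val : hm_coinv -> M).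

Lemma coinvP (b : B) : coact (val b) = val b ⊗ 1.
Proof. by case: b => a /=; rewrite inE => /eqP. Qed.
Lemma hm_coinvP (m : hm_coinv) : hm_coact M (val m) = val m ⊗ 1.
Proof. by case: m => a /=; rewrite inE => /eqP. Qed.

Fact hm_coinv_ract_subproof (m : hm_coinv) (b : B) :
  ract (val m) (val b) \in hm_coinv_pred M.
Proof.
rewrite inE hm_coact_ract coinvP hm_coinvP tmap2E ?mulr1 //.
- exact: ract_bilin.
- exact: bilin_mul.
Qed.
Definition hm_coinv_ract (m : hm_coinv) (b : B) : hm_coinv :=
  HmCoinv (hm_coinv_ract_subproof m b).

Fact hm_coinv_ract_bilin : bilin hm_coinv_ract.
Proof.
split=> [b c x y|m c x y]; apply: val_inj; rewrite [RHS]linearP.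
- exact: ((ract_bilin M).1 (val b) c (val x) (val y)).
- exact: ((ract_bilin M).2 (val m) c (val x) (val y)).
Qed.
Fact hm_coinv_ractA m a b :
  hm_coinv_ract (hm_coinv_ract m a) b = hm_coinv_ract m (a * b).
Proof. by apply: val_inj; rewrite /= ractA. Qed.
Fact hm_coinv_ract1 m : hm_coinv_ract m 1 = m.
Proof. by apply: val_inj; rewrite /= ract1. Qed.

Definition hm_coinv_rmod : rmodule B :=
  RModule hm_coinv_ract_bilin hm_coinv_ractA hm_coinv_ract1.
End HopfCoinvariants.

Definition galois_tens : lmodType k :=
  btens (fun (a : A) (b : B) => a * val b) (fun (b : B) (a : A) => val b * a).

Definition galois_map : galois_tens -> (A ⊗ H)%type :=
  btlift (fun a a' => tmul (a ⊗ 1) (coact a')).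

Lemma galois_mapE (a a' : A) :
  galois_map (bten _ _ a a') = tmul (a ⊗ 1) (coact a').
Proof.
have hb := @tmul_bilin k A H.
rewrite /galois_map btliftE //.
- split=> [v c x y|u c x y].
  + by rewrite tenDl tenZl (bilinDl _ _ _ hb) (bilinZl _ _ _ hb).
  + by rewrite linearP /= (bilinDr _ _ _ hb) (bilinZr _ _ _ hb).
- move=> x b y; rewrite coactM coinvP; elim/tens_ind: (coact y) => [|u v|z t hz ht].
  + by rewrite !(bilin0r _ hb).
  + by rewrite !tmulE !mul1r mulrA.
  + by rewrite !(bilinDr _ _ _ hb) hz ht.
Qed.

Definition hopf_galois : Prop := bijective galois_map.

(* B (x) A carries the coaction id (x) coact, and the second condition on s is
   colinearity, compared in B (x) (A (x) H). *)
Definition principal : Prop :=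
  [/\ hopf_galois,
      bijective (@antipode k H)
    & exists s : {linear A -> (B ⊗ A)%type},
        [/\ forall (b : B) a, s (val b * a) = tmap (lmulf b) idfun (s a),
            forall a, tassoc (tmap s idfun (coact a)) = tmap idfun coact (s a)
          & forall a, tlift (fun (b : B) (a' : A) => val b * a') (s a) = a]].

Section OmegaHopf.

Definition diag_coact : (A ⊗ A)%type -> ((A ⊗ A) ⊗ H)%type :=
  tlift (fun a a' => tmap2 (@ten k A A) (fun x y : H => x * y) (coact a) (coact a')).

Lemma tmap2_ten_bilin : bilin (tmap2 (@ten k A A) (fun x y : H => x * y)).
Proof. by apply: tmap2_bilin; [apply: bilin_ten | apply: bilin_mul]. Qed.

Lemma diag_coact_bilin :
  bilin (fun a a' => tmap2 (@ten k A A) (fun x y : H => x * y) (coact a) (coact a')).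
Proof.
have hb := tmap2_ten_bilin.
split=> [v c x y|u c x y]; rewrite linearP /=.
- by rewrite (bilinDl _ _ _ hb) (bilinZl _ _ _ hb).
- by rewrite (bilinDr _ _ _ hb) (bilinZr _ _ _ hb).
Qed.

Lemma diag_coactE a a' : diag_coact (a ⊗ a') =
  tmap2 (@ten k A A) (fun x y : H => x * y) (coact a) (coact a').
Proof. by rewrite /diag_coact tliftE //; apply: diag_coact_bilin. Qed.

HB.instance Definition _ := GRing.isLinear.Build k _ _ _ diag_coact
  (tlift_linear diag_coact_bilin).

Lemma tmap_mu_tmap2 (X Y : (A ⊗ H)%type) :
  tmap (@mu k A) idfun (tmap2 (@ten k A A) (fun x y : H => x * y) X Y) = tmul X Y.
Proof.
have hb := tmap2_ten_bilin; have hc := @tmul_bilin k A H.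
elim/tens_ind: X => [|a h|X X' hX hX'].
- by rewrite (bilin0l _ hb) (bilin0l _ hc) linear0.
- elim/tens_ind: Y => [|a' h'|Y Y' hY hY'].
  + by rewrite (bilin0r _ hb) (bilin0r _ hc) linear0.
  + rewrite tmap2E ?tmulE ?tmapE /= ?muE //; [exact: bilin_ten | exact: bilin_mul].
  + by rewrite (bilinDr _ _ _ hb) (bilinDr _ _ _ hc) linearD /= hY hY'.
- by rewrite (bilinDl _ _ _ hb) (bilinDl _ _ _ hc) linearD /= hX hX'.
Qed.

Lemma tmap_mu_diag x : tmap (@mu k A) idfun (diag_coact x) = coact (mu x).
Proof.
elim/tens_ind: x => [|a a'|x y hx hy]; first by rewrite !linear0.
- by rewrite diag_coactE tmap_mu_tmap2 muE coactM.
- by rewrite !linearD /= hx hy.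
Qed.

Lemma bilin_compl (U V W W' : lmodType k) (F : U -> V -> W) (L : {linear W -> W'}) :
  bilin F -> bilin (fun x y => L (F x y)).
Proof.
by move=> hF; split=> [v c x y|u c x y]; rewrite ((hF.1, hF.2)) linearP.
Qed.

Lemma bilin_compr (U V U' V' W : lmodType k) (F : U -> V -> W)
    (L : {linear U' -> U}) (L' : {linear V' -> V}) :
  bilin F -> bilin (fun x y => F (L x) (L' y)).
Proof.
move=> hF; split=> [v c x y|u c x y]; rewrite linearP /=.
- exact: hF.1.
- exact: hF.2.
Qed.

Lemma bilin_ext (U V U' V' W : lmodType k)
    (F G : (U ⊗ V)%type -> (U' ⊗ V')%type -> W) :
  bilin F -> bilin G ->
  (forall u v u' v', F (u ⊗ v) (u' ⊗ v') = G (u ⊗ v) (u' ⊗ v')) ->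
  forall x y, F x y = G x y.
Proof.
move=> hF hG e x y; elim/tens_ind: x => [|u v|x x' h h'].
- by rewrite (bilin0l _ hF) (bilin0l _ hG).
- elim/tens_ind: y => [|u' v'|y y' h h'] //.
  + by rewrite (bilin0r _ hF) (bilin0r _ hG).
  + by rewrite (bilinDr _ _ _ hF) (bilinDr _ _ _ hG) h h'.
- by rewrite (bilinDl _ _ _ hF) (bilinDl _ _ _ hG) h h'.
Qed.

Definition tcounit (M : lmodType k) : (M ⊗ H)%type -> M :=
  tlift (fun n h => counit h *: n).
Lemma counit_bilin (M : lmodType k) : bilin (fun (n : M) (h : H) => counit h *: n).
Proof.
split=> [h c x y|n c x y]; first exact: linearP.
by rewrite linearP /= scalerDl scalerA.
Qed.
HB.instance Definition _ M :=
  GRing.isLinear.Build k _ _ _ (@tcounit M) (tlift_linear (counit_bilin M)).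
Lemma tcounitE (M : lmodType k) (n : M) h : tcounit (n ⊗ h) = counit h *: n.
Proof. by rewrite /tcounit tliftE //; apply: counit_bilin. Qed.

Lemma tmap2_ten_tmul_bilin : bilin (tmap2 (@ten k A A) (@tmul k H H)).
Proof. by apply: tmap2_bilin; [apply: bilin_ten | apply: tmul_bilin]. Qed.

Local Notation T2 := (tmap2 (@ten k A A) (fun x y : H => x * y)).
Local Notation T3 := (tmap2 (@ten k A A) (@tmul k H H)).

Lemma T2E (a a' : A) (h h' : H) : T2 (a ⊗ h) (a' ⊗ h') = (a ⊗ a') ⊗ (h * h').
Proof. by rewrite tmap2E //; [apply: bilin_ten | apply: bilin_mul]. Qed.
Lemma T3E (a a' : A) (h h' : (H ⊗ H)%type) :
  T3 (a ⊗ h) (a' ⊗ h') = (a ⊗ a') ⊗ (tmul h h').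
Proof. by rewrite tmap2E //; [apply: bilin_ten | apply: tmul_bilin]. Qed.

Fact tassoc_T2 h h' P Q :
  tassoc (T2 P Q ⊗ (h * h')) = T3 (tassoc (P ⊗ h)) (tassoc (Q ⊗ h')).
Proof.
have hb := tmap2_ten_bilin; have hc := tmap2_ten_tmul_bilin.
elim/tens_ind: P => [|a g|P P' h1 h2].
- by rewrite (bilin0l _ hb) !(bilin0l _ (@bilin_ten _ _ _)) !linear0 (bilin0l _ hc).
- elim/tens_ind: Q => [|a' g'|P P' h1 h2].
  + by rewrite (bilin0r _ hb) !(bilin0l _ (@bilin_ten _ _ _)) !linear0 (bilin0r _ hc).
  + by rewrite T2E !tassocE T3E tmulE.
  + by rewrite (bilinDr _ _ _ hb) !tenDl !linearD /= (bilinDr _ _ _ hc) h1 h2.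
- by rewrite (bilinDl _ _ _ hb) !tenDl !linearD /= (bilinDl _ _ _ hc) h1 h2.
Qed.

Fact diag_T2 X Y : tassoc (tmap diag_coact idfun (T2 X Y)) =
  T3 (tassoc (tmap coact idfun X)) (tassoc (tmap coact idfun Y)).
Proof.
move: X Y; apply: bilin_ext => [||a h a' h'].
- exact: (bilin_compl (tassoc \o tmap diag_coact idfun) tmap2_ten_bilin).
- exact: (bilin_compr (tassoc \o tmap coact idfun) (tassoc \o tmap coact idfun)
           tmap2_ten_tmul_bilin).
- by rewrite T2E !tmapE /= diag_coactE tassoc_T2.
Qed.

Fact comul_T2 X Y : tmap idfun comul (T2 X Y) =
  T3 (tmap idfun comul X) (tmap idfun comul Y).
Proof.
move: X Y; apply: bilin_ext => [||a h a' h'].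
- exact: (bilin_compl (tmap idfun comul) tmap2_ten_bilin).
- exact: (bilin_compr (tmap idfun comul) (tmap idfun comul) tmap2_ten_tmul_bilin).
- by rewrite T2E !tmapE /= T3E comulM.
Qed.

Fact counit_T2 X Y : tcounit (T2 X Y) = tcounit X ⊗ tcounit Y.
Proof.
move: X Y; apply: bilin_ext => [||a h a' h'].
- exact: (bilin_compl (@tcounit _) tmap2_ten_bilin).
- exact: (bilin_compr (@tcounit _) (@tcounit _) (@bilin_ten _ _ _)).
- by rewrite T2E !tcounitE counitM tenZl tenZr scalerA.
Qed.

Lemma tcounit_tmap (U V : lmodType k) (f : {linear U -> V}) X :
  tcounit (tmap f idfun X) = f (tcounit X).
Proof.
elim/tens_ind: X => [|u h|x y hx hy]; first by rewrite !linear0.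
- by rewrite tmapE !tcounitE linearZ.
- by rewrite !linearD /= hx hy.
Qed.

Lemma diag_coactP : is_coaction diag_coact.
Proof.
split=> x.
- elim/tens_ind: x => [|a a'|x y hx hy]; first by rewrite !linear0.
  + by rewrite diag_coactE diag_T2 comul_T2 !(coactP A).1.
  + by rewrite !linearD /= hx hy.
- rewrite -/(tcounit _); elim/tens_ind: x => [|a a'|x y hx hy].
  + by rewrite !linear0.
  + by rewrite diag_coactE counit_T2 /tcounit !(coactP A).2.
  + by rewrite !linearD /= hx hy.
Qed.

(* A k-linear retraction of the inclusion of omega A into A (x) A; it serves to
   write the restricted coaction with values in omega A (x) H
   (see [omega_coactE]). *)
Fact omega_proj_subproof (x : (A ⊗ A)%type) :
  x - 1 ⊗ mu x \in @omega_pred k A.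
Proof. by rewrite inE linearB /= muE mul1r subrr. Qed.
Definition omega_proj (x : (A ⊗ A)%type) : omega A := Omega (omega_proj_subproof x).
Fact omega_proj_linear : linear omega_proj.
Proof.
move=> c x y; apply: val_inj; rewrite [RHS]linearP /= linearP /= tenDr tenZr.
by rewrite scalerBr opprD addrACA.
Qed.
HB.instance Definition _ :=
  GRing.isLinear.Build k _ _ _ omega_proj omega_proj_linear.

Lemma omega_projK (w : omega A) : omega_proj (val w) = w.
Proof.
by apply: val_inj; rewrite /= omegaP (bilin0r _ (@bilin_ten _ _ _)) subr0.
Qed.

Definition omega_coact (w : omega A) : (omega A ⊗ H)%type :=
  tmap omega_proj idfun (diag_coact (val w)).
HB.instance Definition _ := GRing.Linear.copy omega_coact
  (tmap omega_proj idfun \o diag_coact \o (val : omega A -> (A ⊗ A)%type)).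

Lemma omega_coactE w :
  tmap (val : omega A -> (A ⊗ A)%type) idfun (omega_coact w) = diag_coact (val w).
Proof.
have e : forall X : ((A ⊗ A) ⊗ H)%type,
    tmap (val : omega A -> (A ⊗ A)%type) idfun (tmap omega_proj idfun X) =
    X - tmap (@ten k A A 1) idfun (tmap (@mu k A) idfun X).
  elim/tens_ind=> [|x h|x y hx hy].
  - by rewrite !linear0 ?addr0.
  - by rewrite !tmapE /= -[LHS]/((x - 1 ⊗ mu x) ⊗ h) tenDl -!scaleN1r tenZl.
  - by rewrite !linearD /= hx hy ?opprD addrACA.
by rewrite /omega_coact e tmap_mu_diag omegaP !linear0 ?addr0.
Qed.

Lemma tmap_val_inj (W : lmodType k) :
  injective (tmap (val : omega A -> (A ⊗ A)%type) (idfun : W -> W)).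
Proof.
apply: (can_inj (g := tmap omega_proj idfun)) => x.
rewrite tmap_comp -[RHS]tmap_id; apply: eq_tmap => // w /=; exact: omega_projK.
Qed.

Lemma omega_coactP : is_coaction omega_coact.
Proof.
split=> w.
- apply: tmap_val_inj.
  have E X : tmap (val : omega A -> (A ⊗ A)%type) (idfun : (H ⊗ H)%type -> _) X =
      tmap (val : omega A -> (A ⊗ A)%type) (tmap (idfun : H -> H) (idfun : H -> H)) X.
    by apply: eq_tmap => // x; rewrite tmap_id.
  rewrite {1}E -tassoc_tmap tmap_comp.
  have -> : tmap (tmap (val : omega A -> (A ⊗ A)%type) idfun \o omega_coact)
      (idfun \o (idfun : H -> H)) (omega_coact w) =
      tmap diag_coact idfun (tmap (val : omega A -> (A ⊗ A)%type) idfun (omega_coact w)).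
    by rewrite [RHS]tmap_comp; apply: eq_tmap => // v; apply: omega_coactE.
  rewrite omega_coactE (diag_coactP.1) -omega_coactE !tmap_comp.
  by apply: eq_tmap.
- apply: val_inj.
  have := tcounit_tmap (val : omega A -> (A ⊗ A)%type) (omega_coact w).
  rewrite omega_coactE => e; apply: etrans (esym e) _; apply: diag_coactP.2.
Qed.

Local Notation racts := (fun (x : (A ⊗ A)%type) (a : A) => tmap idfun (rmulf a) x).

Fact racts_T2 P Q S :
  T2 P (tmul Q S) = tmap2 racts (fun x y : H => x * y) (T2 P Q) S.
Proof.
have hb := tmap2_ten_bilin; have hm := @tmul_bilin k A H.
have hr : bilin (tmap2 racts (fun x y : H => x * y)).
  by apply: tmap2_bilin; [apply: tmap_rmul_bilin | apply: bilin_mul].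
elim/tens_ind: P => [|u g|P P' h h'].
- by rewrite !(bilin0l _ hb) (bilin0l _ hr).
- elim/tens_ind: Q => [|v h|Q Q' h h'].
  + by rewrite (bilin0l _ hm) !(bilin0r _ hb) (bilin0l _ hr).
  + elim/tens_ind: S => [|w l|S S' h1 h2].
    * by rewrite (bilin0r _ hm) !(bilin0r _ hb) (bilin0r _ hr).
    * rewrite tmulE !T2E tmap2E ?tmapE ?mulrA //; [exact: tmap_rmul_bilin | exact: bilin_mul].
    * by rewrite !(bilinDr _ _ _ hm, bilinDr _ _ _ hb, bilinDr _ _ _ hr) h1 h2.
  + by rewrite (bilinDl _ _ _ hm) !(bilinDr _ _ _ hb) (bilinDl _ _ _ hr) h h'.
- by rewrite !(bilinDl _ _ _ hb) (bilinDl _ _ _ hr) h h'.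
Qed.

Lemma diag_coact_ract x a : diag_coact (tmap idfun (rmulf a) x) =
  tmap2 racts (fun x y : H => x * y) (diag_coact x) (coact a).
Proof.
have hr : bilin (tmap2 racts (fun x y : H => x * y)).
  by apply: tmap2_bilin; [apply: tmap_rmul_bilin | apply: bilin_mul].
elim/tens_ind: x => [|u v|x y hx hy].
- by rewrite !linear0 (bilin0l _ hr).
- by rewrite tmapE !diag_coactE /= coactM racts_T2.
- by rewrite !linearD /= (bilinDl _ _ _ hr) hx hy.
Qed.

Lemma omega_coact_ract (w : omega A) a : omega_coact (omega_ract w a) =
  tmap2 (@omega_ract k A) (fun x y : H => x * y) (omega_coact w) (coact a).
Proof.
apply: tmap_val_inj; rewrite omega_coactE diag_coact_ract -omega_coactE.
move: (omega_coact w) (coact a); apply: bilin_ext => [||v h a' h'].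
- apply: (bilin_compr (tmap val idfun) idfun).
  by apply: tmap2_bilin; [apply: tmap_rmul_bilin | apply: bilin_mul].
- apply: (bilin_compl (tmap val idfun)).
  by apply: tmap2_bilin; [apply: omega_ract_bilin | apply: bilin_mul].
- rewrite tmapE !tmap2E ?tmapE //.
  + exact: omega_ract_bilin.
  + exact: bilin_mul.
  + exact: tmap_rmul_bilin.
  + exact: bilin_mul.
Qed.

Definition omega_hopf : hopf_module :=
  @HopfModule (omega_rmod A) omega_coact omega_coactP omega_coact_ract.

Lemma coact_coinv_mull (b : B) a : coact (val b * a) = tmap (lmulf (val b)) idfun (coact a).
Proof.
have hm := @tmul_bilin k A H.
rewrite coactM coinvP; elim/tens_ind: (coact a) => [|u v|x y hx hy].
- by rewrite linear0 (bilin0r _ hm).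
- by rewrite tmulE tmapE mul1r.
- by rewrite linearD /= (bilinDr _ _ _ hm) hx hy.
Qed.

Definition omega_blact (b : B) (w : omega A) : omega A := omega_lact (val b) w.

Fact omega_blact_bilin : bilin omega_blact.
Proof.
split=> [w c b b'|b]; last exact: (omega_lact_bilin A).2.
exact: ((omega_lact_bilin A).1 w c (val b) (val b')).
Qed.
Fact omega_blactA b c w : omega_blact b (omega_blact c w) = omega_blact (b * c) w.
Proof. exact: omega_lactA. Qed.
Fact omega_blact1 w : omega_blact 1 w = w.
Proof. exact: omega_lact1. Qed.
Fact omega_blact_ract b w a :
  omega_blact b (omega_ract w a) = omega_ract (omega_blact b w) a.
Proof. exact: omega_lract. Qed.

Lemma diag_coact_lact (b : B) x : diag_coact (tmap (lmulf (val b)) idfun x) =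
  tmap (tmap (lmulf (val b)) idfun) idfun (diag_coact x).
Proof.
elim/tens_ind: x => [|u v|x y hx hy]; first by rewrite !linear0.
- rewrite tmapE !diag_coactE /= coact_coinv_mull.
  move: (coact u) (coact v); apply: bilin_ext => [||a h a' h'].
  + exact: (bilin_compr (tmap (lmulf (val b)) idfun) idfun tmap2_ten_bilin).
  + exact: (bilin_compl (tmap (tmap (lmulf (val b)) idfun) idfun) tmap2_ten_bilin).
  + by rewrite tmapE !T2E tmapE /= tmapE.
- by rewrite !linearD /= hx hy.
Qed.

Fact omega_blact_coact b w :
  omega_coact (omega_blact b w) = tmap (omega_blact b) idfun (omega_coact w).
Proof.
apply: tmap_val_inj; rewrite omega_coactE diag_coact_lact -omega_coactE.
rewrite [LHS]tmap_comp [RHS](tmap_comp (omega_lact (val b))).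
by apply: eq_tmap.
Qed.

Definition omega_bhopf : bhopf_module :=
  @BHopfModule omega_hopf omega_blact omega_blact_bilin omega_blactA omega_blact1
    omega_blact_ract omega_blact_coact.
End OmegaHopf.

Section OmegaBTensA.

Definition omegaB_A : lmodType k :=
  btens (@omega_ract k B) (fun (b : B) (a : A) => val b * a).

Definition wten (w : omega B) (a : A) : omegaB_A := bten _ _ w a.

Lemma wten_bilin : bilin wten.
Proof.
by split=> [a c x y|w c x y]; rewrite /wten ?btenDl ?btenDr ?btenZl ?btenZr.
Qed.
Lemma wten_bal w b a : wten (omega_ract w b) a = wten w (val b * a).
Proof. exact: bten_bal. Qed.
HB.instance Definition _ w :=
  GRing.isLinear.Build k _ _ _ (wten w) (wten_bilin.2 w).

Definition wlift (W : lmodType k) (f : omega B -> A -> W) : omegaB_A -> W :=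
  btlift f.

Definition wbalanced (W : lmodType k) (f : omega B -> A -> W) : Prop :=
  forall w b a, f (omega_ract w b) a = f w (val b * a).

Lemma wliftE (W : lmodType k) (f : omega B -> A -> W) w a :
  bilin f -> wbalanced f -> wlift f (wten w a) = f w a.
Proof. exact: btliftE. Qed.
Lemma wlift_linear (W : lmodType k) (f : omega B -> A -> W) :
  bilin f -> wbalanced f -> linear (wlift f).
Proof. exact: btlift_linear. Qed.
Lemma wten_ind (P : omegaB_A -> Prop) :
  P 0 -> (forall w a, P (wten w a)) -> (forall x y, P x -> P y -> P (x + y)) ->
  forall x, P x.
Proof. exact: btens_ind. Qed.

Definition wract (t : omegaB_A) (a : A) : omegaB_A :=
  wlift (fun w a' => wten w (a' * a)) t.

Fact wract_bilin_in a : bilin (fun w a' => wten w (a' * a)).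
Proof. exact: (bilin_compr idfun (rmulf a) wten_bilin). Qed.
Fact wract_bal_in a : wbalanced (fun w a' => wten w (a' * a)).
Proof. by move=> w b a'; rewrite wten_bal mulrA. Qed.
Lemma wractE w a a' : wract (wten w a) a' = wten w (a * a').
Proof. by rewrite /wract wliftE //; [apply: wract_bilin_in | apply: wract_bal_in]. Qed.
Lemma wractDl t t' a : wract (t + t') a = wract t a + wract t' a.
Proof.
have := wlift_linear (wract_bilin_in a) (@wract_bal_in a) 1 t t'.
by rewrite !scale1r.
Qed.
Lemma wract_bilin : bilin wract.
Proof.
split=> [a|t c a a']; first exact: (wlift_linear (wract_bilin_in a) (@wract_bal_in a)).
rewrite /wract /wlift /btlift scaler_sumr -big_split; apply: eq_bigr => p _ /=.
by rewrite mulrDr -scalerAr linearP.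
Qed.
Lemma wractA t a b : wract (wract t a) b = wract t (a * b).
Proof.
have hb := wract_bilin; elim/wten_ind: t => [|w c|x y hx hy].
- by rewrite !(bilin0l _ hb).
- by rewrite !wractE mulrA.
- by rewrite !wractDl hx hy.
Qed.
Lemma wract1 t : wract t 1 = t.
Proof.
have hb := wract_bilin; elim/wten_ind: t => [|w c|x y hx hy].
- by rewrite (bilin0l _ hb).
- by rewrite wractE mulr1.
- by rewrite wractDl hx hy.
Qed.

Definition omegaB_A_rmod : rmodule A := RModule wract_bilin wractA wract1.

Definition wcoact : omegaB_A -> (omegaB_A ⊗ H)%type :=
  wlift (fun w a => tmap (wten w) idfun (coact a)).

Fact tmap_wten_bilin :
  bilin (fun w (x : (A ⊗ H)%type) => tmap (wten w) (idfun : H -> H) x).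
Proof.
split=> [x c w w'|w]; last exact: linearP.
elim/tens_ind: x => [|u v|x y hx hy]; first by rewrite !linear0 ?addr0.
- by rewrite !tmapE /= (bilinDl _ _ _ wten_bilin) (bilinZl _ _ _ wten_bilin) tenDl tenZl.
- by rewrite !linearD /= hx hy addrACA.
Qed.
Fact wcoact_bilin_in : bilin (fun w a => tmap (wten w) (idfun : H -> H) (coact a)).
Proof. exact: (bilin_compr idfun coact tmap_wten_bilin). Qed.
Fact wcoact_bal_in : wbalanced (fun w a => tmap (wten w) (idfun : H -> H) (coact a)).
Proof.
move=> w b a; rewrite coact_coinv_mull tmap_comp; apply: eq_tmap => // x.
exact: wten_bal.
Qed.
HB.instance Definition _ := GRing.isLinear.Build k _ _ _ wcoact
  (wlift_linear wcoact_bilin_in wcoact_bal_in).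
Lemma wcoactE w a : wcoact (wten w a) = tmap (wten w) idfun (coact a).
Proof. by rewrite /wcoact wliftE //; [apply: wcoact_bilin_in | apply: wcoact_bal_in]. Qed.

Lemma wcoactP : is_coaction wcoact.
Proof.
split=> t.
- elim/wten_ind: t => [|w a|x y hx hy]; first by rewrite !linear0.
  + rewrite wcoactE.
    have -> : tmap wcoact idfun (tmap (wten w) idfun (coact a)) =
        tmap (tmap (wten w) idfun) idfun (tmap coact (idfun : H -> H) (coact a)).
      by rewrite !tmap_comp; apply: eq_tmap => // x; rewrite /= wcoactE.
    rewrite tassoc_tmap (coactP A).1 !tmap_comp; apply: eq_tmap => // h.
    by rewrite /= tmap_id.
  + by rewrite !linearD /= hx hy.
- rewrite -/(tcounit _); elim/wten_ind: t => [|w a|x y hx hy]; first by rewrite !linear0.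
  + by rewrite wcoactE tcounit_tmap /tcounit (coactP A).2.
  + by rewrite !linearD /= hx hy.
Qed.

Lemma wcoact_ract (t : omegaB_A) a : wcoact (wract t a) =
  tmap2 wract (fun x y : H => x * y) (wcoact t) (coact a).
Proof.
have hr : bilin (tmap2 wract (fun x y : H => x * y)).
  by apply: tmap2_bilin; [apply: wract_bilin | apply: bilin_mul].
elim/wten_ind: t => [|w c|x y hx hy].
- by rewrite (bilin0l _ wract_bilin) linear0 (bilin0l _ hr).
- rewrite wractE !wcoactE coactM.
  move: (coact c) (coact a); apply: bilin_ext => [||u h u' h'].
  + exact: (bilin_compl (tmap (wten w) idfun) (@tmul_bilin k A H)).
  + exact: (bilin_compr (tmap (wten w) idfun) idfun hr).
  + rewrite tmulE !tmapE tmap2E ?wractE //; [exact: wract_bilin | exact: bilin_mul].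
- by rewrite wractDl !linearD /= (bilinDl _ _ _ hr) hx hy.
Qed.

Definition omegaB_A_hopf : hopf_module :=
  @HopfModule omegaB_A_rmod wcoact wcoactP wcoact_ract.

Definition wblact (b : B) : omegaB_A -> omegaB_A :=
  wlift (fun w a => wten (omega_lact b w) a).

Fact wblact_bilin_in b : bilin (fun w a => wten (omega_lact b w) a).
Proof. exact: (bilin_compr (@omega_lact k B b) idfun wten_bilin). Qed.
Fact wblact_bal_in b : wbalanced (fun w a => wten (omega_lact b w) a).
Proof. by move=> w c a; rewrite omega_lract wten_bal. Qed.
HB.instance Definition _ b := GRing.isLinear.Build k _ _ _ (wblact b)
  (wlift_linear (wblact_bilin_in b) (@wblact_bal_in b)).
Lemma wblactE b w a : wblact b (wten w a) = wten (omega_lact b w) a.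
Proof. by rewrite /wblact wliftE //; [apply: wblact_bilin_in | apply: wblact_bal_in]. Qed.

Lemma wblact_bilin : bilin wblact.
Proof.
split=> [t c b b'|b]; last exact: linearP.
rewrite /wblact /wlift /btlift scaler_sumr -big_split; apply: eq_bigr => p _ /=.
rewrite (bilinDl _ _ _ (omega_lact_bilin B)) (bilinZl _ _ _ (omega_lact_bilin B)).
by rewrite (bilinDl _ _ _ wten_bilin) (bilinZl _ _ _ wten_bilin).
Qed.
Lemma wblactA b c t : wblact b (wblact c t) = wblact (b * c) t.
Proof.
elim/wten_ind: t => [|w a|x y hx hy]; first by rewrite !linear0.
- by rewrite !wblactE omega_lactA.
- by rewrite !linearD /= hx hy.
Qed.
Lemma wblact1 t : wblact 1 t = t.
Proof.
elim/wten_ind: t => [|w a|x y hx hy]; first by rewrite !linear0.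
- by rewrite !wblactE omega_lact1.
- by rewrite !linearD /= hx hy.
Qed.
Lemma wblact_ract b t a : wblact b (wract t a) = wract (wblact b t) a.
Proof.
have hb := wract_bilin; elim/wten_ind: t => [|w c|x y hx hy].
- by rewrite (bilin0l _ hb) !linear0 (bilin0l _ hb).
- by rewrite !(wractE, wblactE).
- by rewrite wractDl !linearD /= wractDl hx hy.
Qed.
Lemma wblact_coact b t : wcoact (wblact b t) = tmap (wblact b) idfun (wcoact t).
Proof.
elim/wten_ind: t => [|w a|x y hx hy]; first by rewrite !linear0.
- rewrite wblactE !wcoactE tmap_comp; apply: eq_tmap => // u /=.
  by rewrite wblactE.
- by rewrite !linearD /= hx hy.
Qed.

Definition omegaB_A_bhopf : bhopf_module :=
  @BHopfModule omegaB_A_hopf wblact wblact_bilin wblactA wblact1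
    wblact_ract wblact_coact.

Fact omega_incl_subproof (w : omega B) :
  tmap (val : B -> A) (val : B -> A) (val w) \in @omega_pred k A.
Proof.
rewrite inE.
have -> : mu (tmap (val : B -> A) (val : B -> A) (val w)) = val (mu (val w)).
  elim/tens_ind: (val w) => [|u v|x y hx hy]; first by rewrite !linear0.
  - by rewrite tmapE !muE rmorphM.
  - by rewrite !linearD /= hx hy.
by rewrite omegaP linear0.
Qed.
Definition omega_incl (w : omega B) : omega A := Omega (omega_incl_subproof w).

Fact omega_incl_linear : linear omega_incl.
Proof.
move=> c x y; apply: val_inj; rewrite [RHS]linearP.
exact: (linearP (tmap (val : B -> A) (val : B -> A)) c (val x) (val y)).
Qed.
HB.instance Definition _ :=
  GRing.isLinear.Build k _ _ _ omega_incl omega_incl_linear.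

Lemma omega_incl_d b : omega_incl (omega_d b) = omega_d (val b).
Proof.
apply: val_inj; rewrite -[LHS]/(tmap (val : B -> A) (val : B -> A) (1 ⊗ b - b ⊗ 1)).
by rewrite linearB /= !tmapE.
Qed.

Lemma omega_incl_ract w b :
  omega_incl (omega_ract w b) = omega_ract (omega_incl w) (val b).
Proof.
apply: val_inj; rewrite -[LHS]/(tmap (val : B -> A) (val : B -> A)
  (tmap idfun (rmulf b) (val w))).
by rewrite [LHS]tmap_comp [RHS](tmap_comp (val : B -> A)); apply: eq_tmap.
Qed.

Definition omegaB_A_incl : omegaB_A -> omega A :=
  wlift (fun w a => omega_ract (omega_incl w) a).

Lemma omegaB_A_inclE w a :
  omegaB_A_incl (wten w a) = omega_ract (omega_incl w) a.
Proof.
rewrite /omegaB_A_incl wliftE //.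
- exact: (bilin_compr omega_incl idfun (omega_ract_bilin A)).
- by move=> v b c; rewrite omega_incl_ract omega_ractA.
Qed.

(* The subspace (omega B) A of omega A. *)
Definition omegaBA (w : omega_bhopf) : Prop :=
  exists t : omegaB_A, omegaB_A_incl t = w.

(* Retractions of (omega B) A in omega A, with values in the isomorphic
   omega B (x)_B A. *)
Definition omegaBA_retraction (Pi : bhom omega_bhopf omegaB_A_bhopf) : Prop :=
  forall t : omegaB_A, Pi (omegaB_A_incl t) = t.

Section Hat.
Variables (M : hopf_module) (f : rhom (omega_rmod B) (hm_coinv_rmod M)).

Definition hat_fun : omegaB_A -> M := wlift (fun w a => ract (val (f w)) a).

Fact hat_bilin_in : bilin (fun (w : omega B) (a : A) => ract (val (f w)) a).
Proof.
split=> [a c v w|w]; last exact: (ract_bilin M).2.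
by rewrite (rhom_linear f) linearP /= ractDl ractZl.
Qed.
Fact hat_bal_in : wbalanced (fun (w : omega B) (a : A) => ract (val (f w)) a).
Proof. by move=> w b a; rewrite (rhom_ract f w b) /= ractA. Qed.
Lemma hat_funE w a : hat_fun (wten w a) = ract (val (f w)) a.
Proof. by rewrite /hat_fun wliftE //; [apply: hat_bilin_in | apply: hat_bal_in]. Qed.
Fact hat_linear : linear hat_fun.
Proof. exact: (wlift_linear hat_bilin_in hat_bal_in). Qed.
HB.instance Definition _ := GRing.isLinear.Build k _ _ _ hat_fun hat_linear.

Fact hat_ract t a : hat_fun (wract t a) = ract (hat_fun t) a.
Proof.
elim/wten_ind: t => [|w c|x y hx hy].
- by rewrite (bilin0l _ wract_bilin) !linear0 ract0l.
- by rewrite wractE !hat_funE ractA.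
- by rewrite wractDl !linearD /= ractDl hx hy.
Qed.

Definition hat : rhom omegaB_A_rmod M :=
  @RHom k A omegaB_A_rmod M hat_fun hat_linear hat_ract.
End Hat.

End OmegaBTensA.
End HopfModules.

(* Main.v *)
Require Import Defs.
From HB Require Import structures.
From mathcomp Require Import all_boot all_algebra.
From mathcomp Require Import boolp classical_sets.
Set Implicit Arguments.
Unset Strict Implicit.
Unset Printing Implicit Defensive.
Import GRing.Theory.
Local Open Scope ring_scope.

(** Write B for the coinvariants, rho for the coaction a ↦ a0 ⊗ a1, and W for
    Omega^1 B ⊗_B A.  A retraction of the inclusion W -> Omega^1 A is the same
    thing as a covariant derivative D : A -> W, that is, a colinear map with
    D(ba) = b D(a) + db ⊗ a and D(1) = 0: as sum a a' = 0 for a form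
    sum a ⊗ a', this form equals - sum d(a) a', and Pi(a ⊗ a') = - D(a) a' is
    right A-linear and colinear.  It is left B-linear because the extra term of
    D(ba) contributes db ⊗ aa', whose sum vanishes on forms; and it is a
    retraction because D(b) = db ⊗ 1 for b in B ([retraction_of_differential]).

    To construct D, let s(a) = s1(a) ⊗ s2(a) be the given splitting.  The formula
    d(s1(a)) ⊗ s2(a) is colinear and satisfies the twisted Leibniz rule, but it
    does not kill 1 unless s(1) = 1 ⊗ 1, which need not hold.
    The correction
      D(a) = d(s1(a)) ⊗ s2(a) + s1(a) d(theta(s2(a)0)) ⊗ j(s2(a)1)
    repairs this.  Here theta : A -> B is a k-linear projection, and
    j : H -> A is a total integral, that is, a unital colinear map; the second
    term is then colinear, and it is left B-linear because s is.  At a = 1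
    colinearity of s forces s(1) to lie in B ⊗ B, where theta is the identity, so
    D(1) = (d(s1(1)) s2(1) + s1(1) d(s2(1))) ⊗ 1 = d(s1(1) s2(1)) ⊗ 1 = d(1) ⊗ 1,
    which is zero ([split_diff1]).

    The projection theta exists because k is a field ([coinv_projection]); this
    is where Zorn's lemma enters.  The total integral comes from the Galois
    property ([total_integral]): a ⊗_B a' ↦ theta(a s1(a')) s2(a') is well
    defined, colinear in a', and maps 1 ⊗_B 1 to s1(1) s2(1) = 1; transported
    along the inverse Galois map it gives a colinear map on A ⊗ H, and j is its
    restriction to 1 ⊗ H.

    Given Pi, the complement of the image of W is the kernel of Pi
    ([omegaBA_direct_summand]).  For the last assertion, f ↦ hat f o Pi lands in
    the colinear maps, where nabla is coinvariant by hypothesis, and it is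
    compatible with the right actions of B because Pi is left B-linear; the
    hom-connection rule for nabla, evaluated on Pi(db) = db ⊗ 1, then becomes the
    rule for the induced map ([coinvariant_connection]). *)

(** * Linear algebra in infinite dimension *)

Definition linear_map (k : fieldType) (U V : lmodType k) (f : U -> V)
    (flin : linear f) : {linear U -> V} :=
  HB.pack_for {linear U -> V} f (GRing.isLinear.Build k U V _ f flin).

(** A maximal linearly closed set meeting N only in 0 is a complement of N. *)
Lemma subspace_projection (k : fieldType) (U : lmodType k) (N : set U) :
  N 0 -> (forall (c : k) x y, N x -> N y -> N (c *: x + y)) ->
  exists p : {linear U -> U}, (forall x, N (p x)) /\ (forall x, N x -> p x = x).
Proof.
move=> N0 Nlin.
pose indep (C : set U) := (forall (c : k) x y, C x -> C y -> C (c *: x + y)) /\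
  (forall x, C x -> N x -> x = 0).
have [F FP Ftot|C [[Clin CN] Cmax]] := @Zorn_bigcup _ indep.
  split=> [c x y [X FX Xx] [Y FY Yy]|x [X FX Xx]]; last exact: (FP X FX).2.
  have [XY|YX] := Ftot X Y FX FY.
  - by exists Y => //; apply: (FP Y FY).1 => //; apply: XY.
  - by exists X => //; apply: (FP X FX).1 => //; apply: YX.
(* The empty set qualifies as well, so 0 in C has to come from maximality. *)
have C0 : C 0.
  have [[c Cc]|Cempty] := pselect (exists c, C c).
    by rewrite -(addNr c) -scaleN1r; apply: Clin.
  exfalso; apply: (Cmax [set 0]%classic).
    by split=> [x Cx|/(_ 0 erefl) C0]; case: Cempty; [exists x | exists 0].
  by split=> [c x y /= -> ->|x /= -> _ //]; rewrite scaler0 addr0.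
have CZ c x : C x -> C (c *: x) by move=> Cx; rewrite -[_ *: _]addr0; apply: Clin.
have NZ c x : N x -> N (c *: x) by move=> Nx; rewrite -[_ *: _]addr0; apply: Nlin.
(* If u had no such component, the span of C and u would contradict maximality. *)
have sumNC u : exists n, N n /\ C (u - n).
  apply: contrapT => notNC.
  pose C' := [set w : U | exists c a, C c /\ w = a *: u + c]%classic.
  apply: (Cmax C').
    split=> [x Cx|C'C]; first by exists x, 0; rewrite scale0r add0r.
    by apply: notNC; exists 0; rewrite subr0; split=> //; apply: C'C; exists 0, 1;
      rewrite scale1r addr0.
  split=> [d x y [c [a [Cc ->]]] [c' [a' [Cc' ->]]]|x [c [a [Cc ->]]] Nx].
    exists (d *: c + c'), (d * a + a'); split; first exact: Clin.
    by rewrite scalerDr scalerDl scalerA addrACA.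
  have [a0|a_neq0] := eqVneq a 0.
    by move: Nx; rewrite a0 scale0r add0r; apply: CN.
  exfalso; apply: notNC; exists (a^-1 *: (a *: u + c)); split; first exact: NZ.
  by rewrite scalerDr scalerA mulVf // scale1r opprD addrA subrr add0r -scaleNr; apply: CZ.
have [p pP] := choice sumNC.
have uniq u n : N n -> C (u - n) -> p u = n.
  move=> Nn Cn; have [Np Cp] := pP u; apply/eqP; rewrite -subr_eq0; apply/eqP/CN.
    rewrite (_ : p u - n = (-1) *: (u - p u) + (u - n)); first exact: Clin.
    by rewrite scaleN1r opprB addrA subrK.
  by rewrite addrC -scaleN1r; apply: Nlin.
have plin : linear p.
  move=> c x y; have [Nx Cx] := pP x; have [Ny Cy] := pP y.
  apply: uniq; first exact: Nlin.
  rewrite (_ : _ - _ = c *: (x - p x) + (y - p y)); first exact: Clin.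
  by rewrite scalerBr opprD addrACA.
exists (linear_map plin); split=> x /=.
  exact: (pP x).1.
by move=> Nx; apply: uniq; rewrite ?subrr.
Qed.

(** On the image of K, g picks the preimage lying in a fixed complement of the
    kernel; g is extended by a projection onto the image. *)
Lemma generalized_inverse (k : fieldType) (U V : lmodType k) (K : {linear U -> V}) :
  exists g : {linear V -> U}, forall u, K (g (K u)) = K u.
Proof.
have [||p [pker pid]] := @subspace_projection k U [set u | K u = 0]%classic.
- by rewrite /= linear0.
- by move=> c x y /= hx hy; rewrite linearP hx hy scaler0 addr0.
have [||q [qim qid]] := @subspace_projection k V [set v | exists u, K u = v]%classic.
- by exists 0; rewrite linear0.
- by move=> c _ _ [x <-] [y <-]; exists (c *: x + y); rewrite linearP.
have [f Kf] := choice qim.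
pose g v := f v - p (f v).
have gE v u : K u = q v -> g v = u - p u.
  move=> Ku; have := pid (u - f v); rewrite /= linearB /= Ku Kf subrr => /(_ erefl).
  rewrite linearB /= /g => /eqP; rewrite subr_eq addrAC eq_sym subr_eq => e.
  by apply/eqP; rewrite subr_eq addrAC eq_sym subr_eq [f v + _]addrC.
have glin : linear g.
  move=> c x y; rewrite (@gE _ (c *: f x + f y)); last by rewrite !linearP /= !Kf.
  by rewrite linearP /= opprD addrACA -scalerBr.
exists (linear_map glin) => u /=.
by rewrite /g linearB /= Kf (pker (f (K u))) subr0 qid //; exists u.
Qed.

(** * Tensor products and the universal calculus *)

Section TensorLemmas.
Variable k : fieldType.

Definition tassocV (U V W : lmodType k) : (U ⊗ (V ⊗ W))%type -> ((U ⊗ V) ⊗ W)%type :=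
  tlift (fun u => tmap (@ten k U V u) idfun).

Lemma tmap_ten_bilin (U V W X : lmodType k) (f : U -> {linear V -> X}) :
  (forall v, linear (f^~ v)) ->
  bilin (fun u => tmap (f u) (idfun : W -> W)).
Proof.
move=> flin; split=> [x c u u'|u]; last exact: linearP.
elim/tens_ind: x => [|v w|x y hx hy]; first by rewrite !linear0 addr0.
- by rewrite !tmapE /= flin tenDl tenZl.
- by rewrite !linearD /= hx hy addrACA.
Qed.

Lemma tassocV_bilin (U V W : lmodType k) :
  bilin (fun u : U => tmap (@ten k U V u) (idfun : W -> W)).
Proof. by apply: tmap_ten_bilin => v; apply: (bilin_ten U V).1. Qed.

HB.instance Definition _ U V W := GRing.isLinear.Build k _ _ _ (@tassocV U V W)
  (tlift_linear (tassocV_bilin U V W)).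

Lemma tassocVE (U V W : lmodType k) (u : U) (x : (V ⊗ W)%type) :
  tassocV (u ⊗ x) = tmap (@ten k U V u) idfun x.
Proof. by rewrite /tassocV tliftE //; apply: tassocV_bilin. Qed.

Lemma tassocK (U V W : lmodType k) : cancel (@tassoc k U V W) (@tassocV U V W).
Proof.
elim/tens_ind=> [|x w|x y hx hy]; first by rewrite !linear0.
- elim/tens_ind: x => [|u v|x y hx hy].
  + by rewrite (bilin0l _ (@bilin_ten _ _ _)) !linear0.
  + by rewrite tassocE tassocVE tmapE.
  + by rewrite tenDl !linearD /= hx hy.
- by rewrite !linearD /= hx hy.
Qed.

Lemma eq_tens_linear (U V W : lmodType k) (f g : {linear (U ⊗ V)%type -> W}) :
  (forall u v, f (u ⊗ v) = g (u ⊗ v)) -> f =1 g.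
Proof.
by move=> e; elim/tens_ind=> [|u v|x y hx hy]; rewrite ?linear0 // !linearD /= hx hy.
Qed.

Lemma tmapDl (U V W : lmodType k) (f g : {linear U -> V}) (x : (U ⊗ W)%type) :
  tmap (f \+ g) (idfun : W -> W) x = tmap f idfun x + tmap g idfun x.
Proof.
apply: (eq_tens_linear (f := tmap (f \+ g) idfun)
  (g := tmap f idfun \+ tmap g idfun)) => u w /=.
by rewrite !tmapE tenDl.
Qed.

Lemma tmapBl (U V W : lmodType k) (f g : {linear U -> V}) (x : (U ⊗ W)%type) :
  tmap (f \- g) (idfun : W -> W) x = tmap f idfun x - tmap g idfun x.
Proof.
apply: (eq_tens_linear (f := tmap (f \- g) idfun)
  (g := tmap f idfun \- tmap g idfun)) => u w /=.
by rewrite !tmapE tenDl -scaleN1r tenZl scaleN1r.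
Qed.

Lemma ten1_linear (U : lmodType k) (R : algType k) :
  linear (fun u : U => u ⊗ (1 : R)).
Proof. exact: (bilin_ten U R).1. Qed.

(** Acting on a coinvariant element, for which the coaction is u ⊗ 1, a diagonal
    coaction reduces to the coaction of the other factor. *)
Lemma tmap2_ten1 (U V W : lmodType k) (R : algType k) (f : U -> V -> W) u x :
  bilin f -> tmap2 f (fun y z : R => y * z) (u ⊗ 1) x = tmap (f u) idfun x.
Proof.
move=> hf; pose fu : {linear V -> W} := linear_map (hf.2 u).
have fuE : f u = fu by [].
rewrite fuE; apply: (eq_tens_linear (g := tmap fu idfun)
  (f := linear_map ((tmap2_bilin hf (bilin_mul R)).2 (u ⊗ 1)))) => v r.
by rewrite [RHS]tmapE /= tmap2E ?mul1r //; apply: bilin_mul.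
Qed.
End TensorLemmas.

Section UniversalDifferential.
Variables (k : fieldType) (R : algType k).

Lemma omega_d_linear : linear (@omega_d k R).
Proof.
move=> c x y; apply: val_inj; rewrite [RHS]linearP /=.
by rewrite tenDl tenDr tenZl tenZr scalerBr opprD addrACA.
Qed.

Lemma bilin_d_ract : bilin (fun b b' : R => omega_ract (omega_d b) b').
Proof.
exact: (bilin_compr (linear_map omega_d_linear) idfun (omega_ract_bilin R)).
Qed.

(** A form in the kernel of mu is minus the sum of its d(b)b', because
    d(b)b' = 1 ⊗ bb' - b ⊗ b'. *)
Lemma omega_generated (w : omega R) :
  tlift (fun b b' : R => omega_ract (omega_d b) b') (val w) = - w.
Proof.
pose L := linear_map (tlift_linear bilin_d_ract).
have valL x : val (L x) = 1 ⊗ mu x - x.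
  apply: (eq_tens_linear (f := (val : omega R -> (R ⊗ R)%type) \o L)
    (g := (@ten k R R 1 \o @mu k R) \- idfun)) => b b' /=.
  rewrite (tliftE _ _ bilin_d_ract) muE /= linearB /= !tmapE /=.
  by rewrite /rmulf mul1r.
apply: val_inj; rewrite -[tlift _ _]/(L (val w)) valL omegaP linear0 add0r.
by rewrite linearN.
Qed.

End UniversalDifferential.

(** * Coinvariants and the Galois map *)

Section Principal.
Variables (k : fieldType) (H : hopf_algebra k) (A : comodule_algebra H).
Local Notation B := (coinv A).

(** With g a generalized inverse of K(a) = rho(a) - a ⊗ 1, whose kernel is B, the
    map id - g K is a projection onto B.  The remainder g K is kept in the
    statement since it shows that theta fixes tensors whose entries are only
    known to be killed by K; see [split_unit_coinv]. *)
Lemma coinv_projection :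
  exists theta : {linear A -> B}, exists g : {linear (A ⊗ H)%type -> A},
    forall a, a = val (theta a) + g (coact a - a ⊗ 1).
Proof.
pose K a : (A ⊗ H)%type := coact a - a ⊗ 1.
have Klin : linear K.
  by move=> c x y; rewrite /K linearP tenDl tenZl scalerBr opprD addrACA.
have [g gK] := generalized_inverse (linear_map Klin).
rewrite /= in gK.
have co a : a - g (K a) \in @coinv_pred k H A.
  rewrite inE -subr_eq0 -/(K _).
  have -> : K (a - g (K a)) = K a - K (g (K a)).
    by rewrite -scaleN1r addrC Klin scaleN1r addrC.
  by rewrite gK subrr.
have tlin : linear (fun a => Coinv (co a)).
  move=> c x y; apply: val_inj; rewrite [RHS]linearP /= Klin linearP /=.
  by rewrite scalerBr opprD addrACA.
exists (linear_map tlin), g => a.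
by rewrite /= subrK.
Qed.

Lemma comul_coact (a : A) :
  tassocV (tmap idfun comul (coact a)) = tmap coact (idfun : H -> H) (coact a).
Proof. by rewrite -(coactP A).1 tassocK. Qed.

Lemma tmul_ten1 (a : A) (x : (A ⊗ H)%type) :
  tmul (a ⊗ 1) x = tmap (lmulf a) idfun x.
Proof. exact: tmap2_ten1 (bilin_mul A). Qed.

Lemma galois_map_linear : linear (@galois_map k H A).
Proof.
apply: btlift_linear.
  exact: (bilin_compr (linear_map (@ten1_linear k A H)) coact (@tmul_bilin k A H)).
move=> a b a'; rewrite !tmul_ten1 coact_coinv_mull tmap_comp.
by apply: eq_tmap => // x /=; rewrite /lmulf mulrA.
Qed.

Definition free_coact : (A ⊗ H)%type -> ((A ⊗ H) ⊗ H)%type :=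
  (@tassocV k A H H) \o (tmap idfun comul).
HB.instance Definition _ := GRing.Linear.on free_coact.

Lemma free_coactE (a : A) (h : H) :
  free_coact (a ⊗ h) = tmap (@ten k A H a) idfun (comul h).
Proof. by rewrite /free_coact /= tmapE tassocVE. Qed.

(** The Galois map is colinear for the coaction of the second factor of
    A ⊗_B A, whose effect on its value a rho(a') is a0' ↦ a rho(a0'). *)
Lemma galois_map_colinear a a' : free_coact (tmul (a ⊗ 1) (coact a')) =
  tmap (tmap (lmulf a) idfun \o coact) idfun (coact a').
Proof.
rewrite tmul_ten1.
transitivity (tmap (tmap (lmulf a) (idfun : H -> H)) (idfun : H -> H)
   (free_coact (coact a'))).
  move: (coact a'); apply: (eq_tens_linear (f := free_coact \o tmap (lmulf a) idfun)
    (g := tmap (tmap (lmulf a) idfun) idfun \o free_coact)) => u h /=.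
  by rewrite tmapE !free_coactE tmap_comp; apply: eq_tmap => // x /=; rewrite tmapE.
by rewrite [free_coact _]comul_coact tmap_comp.
Qed.

(** * A total integral *)

Section Splitting.
Variable (s : {linear A -> (B ⊗ A)%type}).
Hypothesis sB : forall (b : B) a, s (val b * a) = tmap (lmulf b) idfun (s a).
Hypothesis scolin : forall a, tassoc (tmap s idfun (coact a)) = tmap idfun coact (s a).
Hypothesis smu : forall a, tlift (fun (b : B) (a' : A) => val b * a') (s a) = a.

(** B carries the trivial coaction in B ⊗ A, so colinearity of G o s can be
    checked with the left tensor factor fixed. *)
Lemma colinear_split (X : lmodType k) (rho : {linear X -> (X ⊗ H)%type})
    (G : {linear (B ⊗ A)%type -> X}) :
  (forall b a, rho (G (b ⊗ a)) = tmap (fun u => G (b ⊗ u)) idfun (coact a)) ->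
  forall a, rho (G (s a)) = tmap (G \o s) idfun (coact a).
Proof.
move=> hG a; transitivity (tmap G (idfun : H -> H) (tmap s (idfun : H -> H) (coact a)));
  last exact: tmap_comp.
rewrite -[tmap s idfun _]tassocK scolin.
move: (s a); apply: (eq_tens_linear (f := rho \o G)
  (g := tmap G idfun \o (@tassocV k B A H) \o tmap idfun coact)) => b a' /=.
by rewrite hG tmapE tassocVE tmap_comp.
Qed.

Lemma bmul_bilin : bilin (fun (b : B) (a : A) => val b * a).
Proof. exact: (bilin_compr (val : B -> A) idfun (bilin_mul A)). Qed.

Section TotalIntegral.
Hypothesis galois : hopf_galois A.
Variables (theta : {linear A -> B}).
Hypothesis theta_coinv : forall b : B, theta (val b) = b.

(** a s1(a') is pushed back into B by theta: this keeps the product with s2(a')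
    colinear in a', while a s1(a') s2(a') itself would just be a a'. *)
Definition theta_mul_split (a a' : A) : A :=
  mu (tmap ((val : B -> A) \o theta \o lmulf a \o (val : B -> A)) idfun (s a')).

Lemma theta_mul_split_bilin : bilin theta_mul_split.
Proof.
split=> [a' c a a2|a]; last first.
  exact: (linearP (@mu k A \o
    tmap ((val : B -> A) \o theta \o lmulf a \o (val : B -> A)) idfun \o s)).
rewrite /theta_mul_split -[RHS]linearP; congr mu.
apply: ((@tmap_ten_bilin k A B A A
  (fun a => (val : B -> A) \o theta \o lmulf a \o (val : B -> A)) _).1 (s a') c a a2).
by move=> v d x y /=; rewrite /lmulf mulrDl -scalerAl !linearP.
Qed.

Lemma theta_mul_split_balanced (a : A) (b : B) (a' : A) :
  theta_mul_split (a * val b) a' = theta_mul_split a (val b * a').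
Proof.
rewrite /theta_mul_split sB tmap_comp; congr mu; apply: eq_tmap => // c /=.
by rewrite /lmulf /= mulrA.
Qed.

Lemma theta_mul_split_colinear a a' :
  coact (theta_mul_split a a') = tmap (theta_mul_split a) idfun (coact a').
Proof.
apply: (colinear_split (rho := coact)
 (G := @mu k A \o tmap ((val : B -> A) \o theta \o lmulf a \o (val : B -> A)) idfun)).
move=> b x /=; rewrite tmapE muE /= coact_coinv_mull; apply: eq_tmap => // u.
by rewrite tmapE muE.
Qed.

Lemma theta_mul_split11 : theta_mul_split 1 1 = 1.
Proof.
rewrite -[RHS]smu /theta_mul_split; move: (s 1).
apply: (eq_tens_linear (f := @mu k A \o
    tmap ((val : B -> A) \o theta \o lmulf 1 \o (val : B -> A)) idfun)
  (g := linear_map (tlift_linear bmul_bilin))) => b a /=.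
rewrite (tliftE _ _ bmul_bilin) tmapE muE /= /lmulf mul1r.
by rewrite theta_coinv.
Qed.

(** j is h ↦ J(1 ⊗ h), where J o can = theta_mul_split for the Galois map can;
    surjectivity of can reduces colinearity of J to that of theta_mul_split. *)
Lemma total_integral : exists j : {linear H -> A},
  j 1 = 1 /\ forall h, coact (j h) = tmap j idfun (comul h).
Proof.
have [can_inv canK invK] := galois.
have can_inv_lin : linear can_inv :=
  can2_linear (f := linear_map galois_map_linear) canK invK.
pose F := linear_map (btlift_linear theta_mul_split_bilin theta_mul_split_balanced).
have FE a a' : F (bten _ _ a a') = theta_mul_split a a'.
  by apply: btliftE; [apply: theta_mul_split_bilin | apply: theta_mul_split_balanced].
have [J JE] : exists J : {linear (A ⊗ H)%type -> A},
    forall a a', J (tmul (a ⊗ 1) (coact a')) = theta_mul_split a a'.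
  exists (F \o linear_map can_inv_lin) => a a'.
  by rewrite -galois_mapE -FE; exact: (congr1 F (canK _)).
have Jcolin x : coact (J x) = tmap J idfun (free_coact x).
  rewrite -[x]invK; elim/btens_ind: (can_inv x) => [|a a'|y z hy hz].
  - by rewrite -[galois_map _]/(linear_map galois_map_linear 0) !linear0.
  - rewrite galois_mapE JE theta_mul_split_colinear galois_map_colinear tmap_comp.
    by apply: eq_tmap => // u /=; rewrite -tmul_ten1 JE.
  - rewrite (linearD (linear_map galois_map_linear) y z : galois_map (y + z) = _).
    by rewrite !linearD /= hy hz.
exists (J \o @ten k A H 1); split=> [|h] /=.
  by rewrite -[RHS]theta_mul_split11 -JE coact1 tmulE !mulr1.
by rewrite Jcolin free_coactE tmap_comp.
Qed.

End TotalIntegral.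

(** * The covariant derivative *)

Section CovariantDifferential.
Variables (theta : {linear A -> B}) (g : {linear (A ⊗ H)%type -> A}).
Hypothesis theta_g : forall a, a = val (theta a) + g (coact a - a ⊗ 1).
Variable j : {linear H -> A}.
Hypotheses (j1 : j 1 = 1) (jcolin : forall h, coact (j h) = tmap j idfun (comul h)).

Lemma bilin_theta_form : bilin (fun u h => wten (omega_d (theta u)) (j h)).
Proof.
exact: (bilin_compr (linear_map (@omega_d_linear k B) \o theta) j (@wten_bilin k H A)).
Qed.

(** Composed with the coaction, a ↦ d(theta(a0)) ⊗ j(a1), this maps A to
    Omega^1 B ⊗_B A colinearly, although theta is not colinear: the coaction only
    sees the H-leg, on which j is colinear. *)
Definition theta_form : (A ⊗ H)%type -> omegaB_A A :=
  tlift (fun u h => wten (omega_d (theta u)) (j h)).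
HB.instance Definition _ :=
  GRing.isLinear.Build k _ _ _ theta_form (tlift_linear bilin_theta_form).

Lemma theta_formE u h : theta_form (u ⊗ h) = wten (omega_d (theta u)) (j h).
Proof. exact: tliftE bilin_theta_form. Qed.

Lemma theta_form_colinear y :
  wcoact (theta_form y) = tmap theta_form idfun (free_coact y).
Proof.
apply: (eq_tens_linear (f := @wcoact k H A \o theta_form)
  (g := tmap theta_form idfun \o free_coact)) => u h.
rewrite /= theta_formE wcoactE jcolin free_coactE !tmap_comp.
by apply: eq_tmap => // l /=; rewrite theta_formE.
Qed.

Lemma bilin_d_form : bilin (fun b a => wten (omega_d b) a : omegaB_A A).
Proof.
exact: (bilin_compr (linear_map (@omega_d_linear k B)) idfun (@wten_bilin k H A)).
Qed.

Lemma bilin_blact_form : bilin (fun b y => wblact b (theta_form y)).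
Proof. exact: (bilin_compr idfun theta_form (@wblact_bilin k H A)). Qed.

(** Composed with s this is the covariant derivative.  The first summand carries
    the twisted Leibniz rule, the second one the normalization at 1. *)
Definition split_diff : (B ⊗ A)%type -> omegaB_A A :=
  linear_map (tlift_linear bilin_d_form) \+
  (linear_map (tlift_linear bilin_blact_form) \o tmap idfun coact).
HB.instance Definition _ := GRing.Linear.on split_diff.

Lemma split_diffE b a :
  split_diff (b ⊗ a) = wten (omega_d b) a + wblact b (theta_form (coact a)).
Proof.
rewrite -[LHS]/(tlift _ (b ⊗ a) + tlift _ (tmap idfun coact (b ⊗ a))).
by rewrite tmapE !tliftE //; [apply: bilin_blact_form | apply: bilin_d_form].
Qed.

Lemma split_diff_colinear b a :
  wcoact (split_diff (b ⊗ a)) = tmap (fun u => split_diff (b ⊗ u)) idfun (coact a).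
Proof.
rewrite split_diffE linearD /= wcoactE wblact_coact theta_form_colinear.
rewrite [free_coact _]comul_coact !tmap_comp -tmapDl.
by apply: eq_tmap => // u; rewrite split_diffE.
Qed.

Lemma split_diff_lmul b z : split_diff (tmap (lmulf b) idfun z) =
  wblact b (split_diff z) + wten (omega_d b) (tlift (fun (b : B) a => val b * a) z).
Proof.
apply: (eq_tens_linear (f := split_diff \o tmap (lmulf b) idfun)
  (g := (wblact b \o split_diff) \+ (wten (omega_d b) \o
          linear_map (tlift_linear bmul_bilin)))) => c a /=.
rewrite tmapE !split_diffE (tliftE _ _ bmul_bilin) linearD /= wblactE wblactA.
rewrite omega_dM (bilinDl _ _ _ (@wten_bilin k H A)) wten_bal.
by rewrite -addrA addrC.
Qed.

Lemma coact_split_unit : tmap idfun coact (s 1) = tassoc (s 1 ⊗ 1).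
Proof. by rewrite -scolin coact1 tmapE. Qed.

(** The previous identity says that s(1) is killed by id ⊗ K, where
    K(a) = rho(a) - a ⊗ 1; hence it is fixed by id ⊗ theta, and lies in B ⊗ B. *)
Lemma split_unit_coinv : tmap idfun ((val : B -> A) \o theta) (s 1) = s 1.
Proof.
have theta_gB (x : (B ⊗ A)%type) : x = tmap idfun ((val : B -> A) \o theta) x +
    tmap idfun g (tmap idfun coact x - tassoc (x ⊗ 1)).
  apply: (eq_tens_linear (f := idfun) (g := tmap idfun ((val : B -> A) \o theta) \+
    (tmap idfun g \o (tmap idfun coact \-
      (tassoc \o linear_map (@ten1_linear k (B ⊗ A)%type H)))))) => b a /=.
  rewrite [tassoc _]tassocE !tmapE /= -linearB tmapE -linearD /=.
  by rewrite -theta_g.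
by rewrite [RHS]theta_gB coact_split_unit subrr linear0 addr0.
Qed.

Lemma theta_coinv (b : B) : theta (val b) = b.
Proof.
by apply: val_inj; rewrite [RHS]theta_g coinvP subrr linear0 addr0.
Qed.

(** For z = s(1) the coaction in [split_diff] can be replaced by a ↦ a ⊗ 1, and
    z by its projection to B ⊗ B; then the Leibniz rule turns split_diff z into
    d(mu z) ⊗ 1 = d(1) ⊗ 1. *)
Lemma split_diff1 : split_diff (s 1) = 0.
Proof.
(* The variant of split_diff with a ⊗ 1 in place of the coaction of a. *)
pose Q : {linear (B ⊗ A)%type -> omegaB_A A} := linear_map (tlift_linear bilin_d_form) \+
  (linear_map (tlift_linear bilin_blact_form) \o
    (tassoc \o linear_map (@ten1_linear k (B ⊗ A)%type H))).
have QE (z : (B ⊗ A)%type) : Q (tmap idfun ((val : B -> A) \o theta) z) =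
    wten (omega_d (mu (tmap idfun theta z))) 1.
  pose R : {linear (B ⊗ A)%type -> omegaB_A A} :=
    linear_map ((@wten_bilin k H A).1 1) \o linear_map (@omega_d_linear k B) \o
      @mu k B \o tmap idfun theta.
  suff e : Q \o tmap idfun ((val : B -> A) \o theta) =1 R by exact: e.
  apply: eq_tens_linear => b a; rewrite /= !tmapE muE /= [tassoc _]tassocE !tliftE;
    [|exact: bilin_blact_form|exact: bilin_d_form].
  rewrite theta_formE theta_coinv j1 wblactE omega_dM.
  by rewrite (bilinDl _ _ _ (@wten_bilin k H A)) wten_bal mulr1.
have -> : split_diff (s 1) = Q (s 1).
  by rewrite /Q /= -coact_split_unit.
rewrite -split_unit_coinv QE.
have -> : mu (tmap idfun theta (s 1)) = 1.
  apply: val_inj; rewrite -[RHS]smu -[in RHS]split_unit_coinv.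
  apply: (eq_tens_linear (f := (val : B -> A) \o @mu k B \o tmap idfun theta)
    (g := linear_map (tlift_linear bmul_bilin) \o
       tmap idfun ((val : B -> A) \o theta))) => b a /=.
  by rewrite !tmapE muE (tliftE _ _ bmul_bilin).
have -> : omega_d (1 : B) = 0 by apply: val_inj; rewrite /= subrr.
by rewrite (bilin0l _ (@wten_bilin k H A)).
Qed.

Lemma covariant_differential : exists D : {linear A -> omegaB_A A},
  [/\ forall b a, D (val b * a) = wblact b (D a) + wten (omega_d b) a,
     D 1 = 0
   & forall a, wcoact (D a) = tmap D idfun (coact a)].
Proof.
exists (split_diff \o s); split=> [b a||a].
- by rewrite /= sB split_diff_lmul smu.
- exact: split_diff1.
- exact: (colinear_split (rho := @wcoact k H A) split_diff_colinear).
Qed.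
End CovariantDifferential.
End Splitting.
End Principal.

(** * The inclusion as a morphism *)

Section Retraction.
Variables (k : fieldType) (H : hopf_algebra k) (A : comodule_algebra H).
Local Notation B := (coinv A).

Lemma omegaB_A_incl_linear : linear (@omegaB_A_incl k H A).
Proof.
apply: wlift_linear; first exact: (bilin_compr (@omega_incl k H A) idfun (omega_ract_bilin A)).
by move=> v b c; rewrite omega_incl_ract omega_ractA.
Qed.
HB.instance Definition _ := GRing.isLinear.Build k _ _ _ (@omegaB_A_incl k H A)
  omegaB_A_incl_linear.

Lemma omegaB_A_incl_ract (t : omegaB_A A) a :
  omegaB_A_incl (wract t a) = omega_ract (omegaB_A_incl t : omega A) a.
Proof.
elim/wten_ind: t => [|w c|x y hx hy].
- rewrite (bilin0l _ (@wract_bilin k H A)) !linear0.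
  by rewrite (bilin0l _ (omega_ract_bilin A)).
- by rewrite wractE !omegaB_A_inclE omega_ractA.
- by rewrite wractDl !linearD /= hx hy (bilinDl _ _ _ (omega_ract_bilin A)).
Qed.

Lemma omega_incl_lact (b : B) (w : omega B) :
  omega_incl (omega_lact b w) = omega_lact (val b) (omega_incl w).
Proof.
apply: val_inj; rewrite -[LHS]/(tmap (val : B -> A) (val : B -> A)
  (tmap (lmulf b) idfun (val w))).
by rewrite [LHS]tmap_comp [RHS](tmap_comp (val : B -> A)); apply: eq_tmap.
Qed.

Lemma omegaB_A_incl_blact (b : B) (t : omegaB_A A) :
  omegaB_A_incl (wblact b t) = omega_blact b (omegaB_A_incl t).
Proof.
elim/wten_ind: t => [|w c|x y hx hy].
- by rewrite !linear0 (bilin0r _ (@omega_blact_bilin k H A)).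
- by rewrite wblactE !omegaB_A_inclE omega_incl_lact omega_blact_ract.
- by rewrite !linearD /= hx hy (bilinDr _ _ _ (@omega_blact_bilin k H A)).
Qed.

Lemma omega_coact_incl (w : omega B) :
  omega_coact (omega_incl w) = omega_incl w ⊗ (1 : H).
Proof.
apply: tmap_val_inj; rewrite omega_coactE tmapE /=.
move: (val w); apply: (eq_tens_linear
  (f := @diag_coact k H A \o tmap (val : B -> A) (val : B -> A))
  (g := linear_map (@ten1_linear k _ H) \o tmap (val : B -> A) (val : B -> A))) => b c /=.
by rewrite !tmapE diag_coactE !coinvP T2E mulr1.
Qed.

Lemma omegaB_A_incl_coact (t : omegaB_A A) :
  omega_coact (omegaB_A_incl t) = tmap (@omegaB_A_incl k H A) idfun (wcoact t).
Proof.
elim/wten_ind: t => [|w a|x y hx hy]; first by rewrite !linear0.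
- rewrite omegaB_A_inclE omega_coact_ract omega_coact_incl wcoactE tmap_comp.
  rewrite (tmap2_ten1 _ _ (omega_ract_bilin A)).
  by apply: eq_tmap => // u; rewrite /= omegaB_A_inclE.
- by rewrite !linearD /= hx hy.
Qed.

(** * From a covariant derivative to a retraction *)

Section FromDifferential.
Variable D : {linear A -> omegaB_A A}.
Hypothesis DB : forall b a, D (val b * a) = wblact b (D a) + wten (omega_d b) a.
Hypothesis D1 : D 1 = 0.
Hypothesis Dcolin : forall a, wcoact (D a) = tmap D idfun (coact a).

Lemma D_coinv (b : B) : D (val b) = wten (omega_d b) 1.
Proof. by rewrite -[val b]mulr1 DB D1 linear0 add0r. Qed.

Lemma ext_form_bilin : bilin (fun a a' => - wract (D a) a').
Proof.
split=> [a' c x y|a c x y].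
- by rewrite linearP (wract_bilin _).1 scalerN opprD.
- by rewrite (wract_bilin _).2 scalerN opprD.
Qed.

(** On the kernel of mu this is the A-linear extension of da ↦ D(a): a form
    sum a ⊗ a' there equals - sum d(a) a'. *)
Definition ext_form : (A ⊗ A)%type -> omegaB_A A := tlift (fun a a' => - wract (D a) a').
HB.instance Definition _ := GRing.isLinear.Build k _ _ _ ext_form
  (tlift_linear ext_form_bilin).

Lemma ext_formE a a' : ext_form (a ⊗ a') = - wract (D a) a'.
Proof. exact: tliftE ext_form_bilin. Qed.

Lemma ext_form_ract x a : ext_form (tmap idfun (rmulf a) x) = wract (ext_form x) a.
Proof.
have hw := @wract_bilin k H A.
apply: (eq_tens_linear (f := ext_form \o tmap idfun (rmulf a))
  (g := linear_map (hw.1 a) \o ext_form)) => u v /=.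
by rewrite tmapE !ext_formE -scaleN1r (bilinZl _ _ _ hw) wractA scaleN1r.
Qed.

(** The defect of left B-linearity depends on mu x only, and so disappears on
    Omega^1 A. *)
Lemma ext_form_lact b x : ext_form (tmap (lmulf (val b)) idfun x) =
  wblact b (ext_form x) - wten (omega_d b) (mu x).
Proof.
apply: (eq_tens_linear (f := ext_form \o tmap (lmulf (val b)) idfun)
  (g := (wblact b \o ext_form) \- (wten (omega_d b) \o @mu k A))) => u v /=.
rewrite tmapE !ext_formE muE DB wractDl wractE linearN /= wblact_ract.
by rewrite opprD.
Qed.

Lemma ext_form_coact x :
  wcoact (ext_form x) = tmap ext_form idfun (diag_coact x).
Proof.
apply: (eq_tens_linear (f := @wcoact k H A \o ext_form)
  (g := tmap ext_form idfun \o @diag_coact k H A)) => a a' /=.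
rewrite ext_formE linearN /= wcoact_ract Dcolin diag_coactE.
move: (coact a) (coact a').
have hr : bilin (tmap2 (@wract k H A) (fun x y : H => x * y)).
  by apply: tmap2_bilin; [apply: wract_bilin | apply: bilin_mul].
apply: bilin_ext => [||u h v l].
- split=> [y c z z'|z c y y'].
    by rewrite linearP hr.1 scalerN opprD.
  by rewrite hr.2 scalerN opprD.
- exact: (bilin_compl (tmap ext_form idfun) (@tmap2_ten_bilin k H A)).
- rewrite T2E !tmapE tmap2E /= ?ext_formE; [|exact: wract_bilin|exact: bilin_mul].
  by rewrite -[- wract _ _]scaleN1r tenZl scaleN1r.
Qed.

Lemma ext_form_incl (w : omega B) : ext_form (val (omega_incl w)) = wten w 1.
Proof.
pose L := linear_map (tlift_linear (@bilin_d_ract k B)).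
pose R : {linear (B ⊗ B)%type -> omegaB_A A} :=
  linear_map ((@wten_bilin k H A).1 1) \o L.
have e : ext_form \o tmap (val : B -> A) (val : B -> A) =1 R \o -%R.
  apply: eq_tens_linear => b c.
  rewrite -[RHS]/(R (- (b ⊗ c))) linearN /= tmapE ext_formE D_coinv; congr (- _).
  by rewrite (tliftE _ _ (@bilin_d_ract k B)) wractE wten_bal mul1r mulr1.
transitivity (R (- val w)); first exact: (e (val w)).
pose wt := linear_map ((@wten_bilin k H A).1 1).
have Lw : L (val w) = - w := omega_generated w.
by rewrite linearN -[R _]/(wt (L (val w))) Lw linearN opprK.
Qed.

Lemma retraction_of_differential :
  exists Pi : bhom (omega_bhopf A) (omegaB_A_bhopf A), omegaBA_retraction Pi.
Proof.
pose f (w : omega A) : omegaB_A A := ext_form (val w).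
have flin : linear f := linearP (ext_form \o (val : omega A -> (A ⊗ A)%type)).
have fract w a : f (omega_ract w a) = wract (f w) a by exact: ext_form_ract.
pose Pi := @RHom k A (omega_rmod A) (omegaB_A_rmod A) f flin fract.
have Pico : colinear (M := omega_hopf A) (N := omegaB_A_hopf A) Pi.
  move=> w; rewrite [LHS]ext_form_coact -omega_coactE tmap_comp.
  by apply: eq_tmap.
have Pibl (b : B) w : Pi (omega_blact b w) = wblact b (Pi w).
  by rewrite [LHS]ext_form_lact omegaP linear0 subr0.
exists (@BHom k H A (omega_bhopf A) (omegaB_A_bhopf A) Pi Pico Pibl).
elim/wten_ind=> [|w a|x y hx hy].
- by rewrite !linear0.
- by rewrite omegaB_A_inclE [LHS]fract [f _]ext_form_incl wractE mul1r.
- rewrite [omegaB_A_incl _]linearD; apply: etrans (linearD Pi _ _) _.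
  by congr (_ + _); [apply: hx | apply: hy].
Qed.

End FromDifferential.

Lemma principal_retraction : principal A ->
  exists Pi : bhom (omega_bhopf A) (omegaB_A_bhopf A), omegaBA_retraction Pi.
Proof.
move=> [galois _ [s [sB scolin smu]]].
have [theta [g theta_g]] := @coinv_projection k H A.
have [j [j1 jcolin]] := total_integral sB scolin smu galois (theta_coinv theta_g).
have [D [DB D1 Dcolin]] := covariant_differential sB scolin smu theta_g j1 jcolin.
exact: retraction_of_differential DB D1 Dcolin.
Qed.

(** * The direct summand *)

Section Summand.
Variable Pi : bhom (omega_bhopf A) (omegaB_A_bhopf A).
Hypothesis PiK : omegaBA_retraction Pi.

Lemma tens_seqP (U V : lmodType k) (x : (U ⊗ V)%type) :
  exists r : seq (U * V), x = \sum_(p <- r) p.1 ⊗ p.2.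
Proof. by exists (repr x); exact: btens_reprE. Qed.

Lemma in_tens_image (U U' V : lmodType k) (f : {linear U -> U'}) (N : U' -> Prop)
    (x : (U ⊗ V)%type) : (forall u, N (f u)) -> in_tens N (tmap f idfun x).
Proof.
move=> Nf; have [r ->] := tens_seqP x; exists [seq (f p.1, p.2) | p <- r].
  by move=> _ /mapP[p _ ->]; apply: Nf.
by rewrite linear_sum big_map; apply: eq_bigr => p _ /=; rewrite tmapE.
Qed.

Lemma omegaBA_subobject : is_subobject (@omegaBA k H A).
Proof.
split=> [|c _ _ [x <-] [y <-]|_ a [t <-]|b _ [t <-]|_ [t <-]].
- by exists 0; rewrite linear0.
- by exists (c *: x + y); rewrite linearP.
- by exists (wract t a); exact: omegaB_A_incl_ract.
- by exists (wblact b t); exact: omegaB_A_incl_blact.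
- by rewrite [hm_coact _ _]omegaB_A_incl_coact; apply: in_tens_image => u; exists u.
Qed.

Lemma retraction_compl (w : omega_bhopf A) : Pi (w - omegaB_A_incl (Pi w)) = 0.
Proof.
apply: etrans (linearB Pi _ _) _.
by apply/eqP; rewrite subr_eq0; apply/eqP/esym/PiK.
Qed.

(** The delicate point is that the coaction of x in the kernel lies in the tensor
    product of the kernel with H: by colinearity it is unchanged by
    (id - incl o Pi) ⊗ id, and id - incl o Pi has values in the kernel. *)
Lemma ker_retraction_subobject : is_subobject (fun w : omega_bhopf A => Pi w = 0).
Proof.
split=> [|c x y x0 y0|x a x0|b x x0|x x0].
- by rewrite linear0.
- by rewrite linearP /= x0 y0 scaler0 addr0.
- by rewrite rhom_ract x0 ract0l.
- by rewrite bhom_blact x0 (bilin0r _ (blact_bilin (omegaB_A_bhopf A))).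
pose Pi' : {linear omega A -> omegaB_A A} := linear_map (rhom_linear Pi).
pose q : {linear omega A -> omega A} := idfun \- (@omegaB_A_incl k H A \o Pi').
have e : omega_coact x = tmap q idfun (omega_coact x).
  rewrite tmapBl tmap_id -(tmap_comp Pi' idfun (@omegaB_A_incl k H A) idfun).
  have -> : tmap Pi' idfun (omega_coact x) = wcoact (Pi x).
    by rewrite -[RHS]/(hm_coact _ (Pi x)) (bhom_colinear Pi x).
  by rewrite (x0 : Pi x = 0 :> omegaB_A A) !linear0 addr0.
by rewrite [hm_coact _ x]e; apply: in_tens_image => w; apply: retraction_compl.
Qed.

Lemma omegaBA_direct_summand : direct_summand (X := omega_bhopf A) (@omegaBA k H A).
Proof.
split; first exact: omegaBA_subobject.
exists (fun w => Pi w = 0); split; first exact: ker_retraction_subobject.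
  move=> w; exists (omegaB_A_incl (Pi w)), (w - omegaB_A_incl (Pi w)); split.
  - by exists (Pi w).
  - exact: retraction_compl.
  - by rewrite addrC subrK.
move=> _ [t <-] Pt0; have -> : t = 0 by rewrite -[t]PiK.
by rewrite linear0.
Qed.
End Summand.

(** * The induced hom-connection *)

Section CoinvariantConnection.
Variables (M : hopf_module A) (nabla : {linear rhom (omega_rmod A) M -> M}).
Hypothesis nabla_conn : hom_connection nabla.
Hypothesis nabla_coinv : forall f : rhom (omega_rmod A) M,
  colinear (M := omega_hopf A) (N := M) f -> hm_coact M (nabla f) = nabla f ⊗ 1.
Variable Pi : bhom (omega_bhopf A) (omegaB_A_bhopf A).
Hypothesis PiK : omegaBA_retraction Pi.
Local Notation MB := (hm_coinv_rmod M).

Lemma hat_colinear (f : rhom (omega_rmod B) MB) :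
  colinear (M := omegaB_A_hopf A) (N := M) (hat f).
Proof.
move=> t; rewrite -[hm_coact (omegaB_A_hopf A) t]/(wcoact t) /=.
elim/wten_ind: t => [|w a|x y hx hy]; first by rewrite !linear0.
- rewrite hat_funE hm_coact_ract hm_coinvP wcoactE tmap_comp.
  rewrite (tmap2_ten1 _ _ (ract_bilin M)).
  by apply: eq_tmap => // u; rewrite /= hat_funE.
- by rewrite !linearD /= hx hy.
Qed.

Definition hat_retraction (f : rhom (omega_rmod B) MB) : rhom (omega_rmod A) M :=
  rhom_comp (hat f) Pi.

Lemma hat_retraction_colinear f :
  colinear (M := omega_hopf A) (N := M) (hat_retraction f).
Proof.
move=> w; rewrite [LHS]hat_colinear (bhom_colinear Pi w).
by rewrite (tmap_comp Pi idfun (hat f) idfun).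
Qed.

Lemma hat_retraction_linear : linear hat_retraction.
Proof.
move=> c f g; apply: rhomP => w; rewrite rhom_addE rhom_scaleE.
suff e t : hat_fun (c *: f + g) t = c *: hat_fun f t + hat_fun g t by exact: e.
elim/wten_ind: t => [|v a|x y hx hy].
- by rewrite !linear0 addr0.
- by rewrite !hat_funE rhom_addE rhom_scaleE linearP ractDl ractZl.
- by rewrite !linearD /= hx hy addrACA.
Qed.

(** Left B-linearity of Pi is what makes f ↦ hat f o Pi compatible with the
    right actions of B on homomorphisms. *)
Lemma hat_retraction_act f (b : B) : hat_retraction (rhom_omega_act f b) =
  rhom_omega_act (hat_retraction f) (val b).
Proof.
apply: rhomP => w /=; rewrite [Pi (omega_lact _ _)](bhom_blact Pi b w) /=.
elim/wten_ind: (Pi w) => [|v a|x y hx hy].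
- by rewrite !linear0.
- by rewrite wblactE !hat_funE.
- by rewrite !linearD /= hx hy.
Qed.

(** Here Pi(db) = db ⊗ 1 is used, the retraction property on Omega^1 B. *)
Lemma hat_retraction_d f (b : B) :
  hat_retraction f (omega_d (val b)) = val (f (omega_d b)).
Proof.
rewrite /= -omega_incl_d -[omega_incl _]omega_ract1 -omegaB_A_inclE PiK.
by rewrite hat_funE ract1.
Qed.

Lemma coinvariant_connection : exists nabla_coH : {linear rhom (omega_rmod B) MB -> MB},
  (forall f, hm_coinv_val (nabla_coH f) = nabla (rhom_comp (hat f) Pi)) /\
  hom_connection nabla_coH.
Proof.
have co f : nabla (hat_retraction f) \in @hm_coinv_pred k H A M.
  by rewrite inE; apply/eqP/nabla_coinv/hat_retraction_colinear.
have nlin : linear (fun f => HmCoinv (co f) : MB).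
  move=> c f g; apply: val_inj; rewrite [RHS]linearP /= hat_retraction_linear.
  exact: linearP.
exists (linear_map nlin); split=> // f b; apply: val_inj.
rewrite [RHS]linearD /= hat_retraction_act nabla_conn.
by rewrite hat_retraction_d.
Qed.
End CoinvariantConnection.

End Retraction.

Theorem corollary4p4 (k : fieldType) (H : hopf_algebra k)
    (antipode_bij : bijective (@antipode k H))
    (A : comodule_algebra H) (A_principal : principal A) :
  [/\ direct_summand (X := omega_bhopf A) (@omegaBA k H A),
      exists Pi : bhom (omega_bhopf A) (omegaB_A_bhopf A), omegaBA_retraction Pi
    & forall (M : hopf_module A)
             (nabla : {linear rhom (omega_rmod A) M -> M}),
        hom_connection nabla ->
        (forall f : rhom (omega_rmod A) M,
            colinear (M := omega_hopf A) (N := M) f ->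
            hm_coact M (nabla f) = nabla f ⊗ 1) ->
        forall Pi : bhom (omega_bhopf A) (omegaB_A_bhopf A),
          omegaBA_retraction Pi ->
          exists nabla_coH :
              {linear rhom (omega_rmod (coinv A)) (hm_coinv_rmod M) ->
                      hm_coinv_rmod M},
            (forall f, hm_coinv_val (nabla_coH f) =
                       nabla (rhom_comp (hat f) Pi)) /\
            hom_connection nabla_coH].
Proof.
have [Pi PiK] := principal_retraction A_principal.
split; first exact: omegaBA_direct_summand PiK.
  by exists Pi.
by move=> M nabla conn co Pi' Pi'K; apply: coinvariant_connection.
Qed.
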